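(* Let $G$ be a simply connected five dimensional nilpotent Lie group with a left invariant Riemannian metric $\tilde a$, whose Lie algebra $\mathfrak l_{5,5}$ has an $\tilde a$-orthonormal basis $\{E_1,\dots,E_5\}$ with non-zero brackets $[E_1,E_2]=aE_4+bE_5$, $[E_1,E_3]=cE_5$, $[E_1,E_4]=dE_5$, $[E_2,E_3]=eE_5$, where $a,d,e>0$ and $b,c\ge0$. If $F$ is any left invariant non-Riemannian $(\alpha,\beta)$-metric of Douglas type on $G$ defined by $\tilde a$ and a left invariant vector field $X$, then $F$ must be a Randers metric.
   Context: Brackets of basis elements not listed (and not obtained by antisymmetry) are zero. An $(\alpha,\beta)$-metric is a Finsler metric $F=\alpha\,\phi(\beta/\alpha)$, where $\alpha(x,y)=\sqrt{\tilde a(y,y)}$ is the norm of a Riemannian metric $\tilde a$, $\beta$ is a 1-form, and $\phi:(-b_0,b_0)\to\mathbb R^+$ is a $C^\infty$ function with $\phi(s)-s\phi'(s)+(b^2-s^2)\phi''(s)>0$ for $|s|\le b<b_0$ (here $b$ is a real variable unrelated to the structure constant $b$), and $\|\beta_x\|_\alpha<b_0$ for all $x$. It is defined by $\tilde a$ and a vector field $X$ if $\beta(x,y)=\tilde a(y,X(x))$; here $\tilde a$ and $X$ are left invariant. A Randers metric is a Finsler metric of the form $\alpha+\beta$ (the case $\phi(s)=1+s$, $b_0=1$), with $\alpha$ the norm of a Riemannian metric and $\beta$ a 1-form of $\alpha$-norm less than one. The spray coefficients of $F$ in standard local coordinates $(x,y)$ of the tangent bundle are $G^i=\frac14 g^{il}\big([F^2]_{x^my^l}y^m-[F^2]_{x^l}\big)$,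 where $g_{ij}=\frac12\frac{\partial^2F^2}{\partial y^i\partial y^j}$. $F$ is of Douglas type if in every standard local coordinate system $G^i=\frac12\Gamma^i_{jk}(x)y^jy^k+P(x,y)y^i$ for some functions $\Gamma^i_{jk}(x)$ and some local function $P(x,y)$ positively homogeneous of degree one in $y$. *)

(* Defs.v *)
From HB Require Import structures.
From mathcomp Require Import all_boot all_order all_algebra.
From mathcomp Require Import all_classical all_reals all_analysis.
Set Implicit Arguments.
Unset Strict Implicit.
Unset Printing Implicit Defensive.
Import Order.TTheory GRing.Theory Num.Theory.
Import numFieldNormedType.Exports.
Local Open Scope classical_set_scope.
Local Open Scope ring_scope.

(* For finite-dimensional V and open U this is the usual class C^k: all
   directional derivatives of order <= k exist and are continuous on U. *)
Fixpoint Ck_on (R : realType) (V W : normedModType R) (k : nat)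
    (U : set V) (f : V -> W) : Prop :=
  (forall x, U x -> {for x, continuous f}) /\
  match k with
  | 0 => True
  | k'.+1 => forall v : V,
      (forall x, U x -> derivable f x v) /\ Ck_on k' U (fun x => 'D_v f x)
  end.

Definition smooth_on (R : realType) (V W : normedModType R)
  (U : set V) (f : V -> W) : Prop := forall k, Ck_on k U f.

#[short(type="groupTopologicalType")]
HB.structure Definition GroupTopological := {G of Group G & Topological G}.

Definition path_connected_space (R : realType) (M : topologicalType) : Prop :=
  forall p q : M, exists gamma : R -> M,
    [/\ {within `[0, 1], continuous gamma}, gamma 0 = p & gamma 1 = q].

(* Loops are contracted relative to their base point. *)
Definition simply_connected (R : realType) (M : topologicalType) : Prop :=
  path_connected_space R M /\
  forall gamma : R -> M, {within `[0, 1], continuous gamma} ->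
    gamma 0 = gamma 1 ->
    exists H : R * R -> M,
      [/\ {within `[0, 1] `*` `[0, 1], continuous H},
          forall t, t \in `[0, 1] -> H (0, t) = gamma t,
          forall t, t \in `[0, 1] -> H (1, t) = gamma 0 &
          forall s, s \in `[0, 1] -> H (s, 0) = gamma 0 /\ H (s, 1) = gamma 0].

Fixpoint upper_central (G : groupType) (k : nat) : set G :=
  match k with
  | 0 => [set 1%g]
  | k'.+1 => [set x | forall y : G, upper_central k' [~ x, y]%g]
  end.

Definition nilpotent_group (G : groupType) : Prop :=
  exists k, upper_central k = [set: G].

Section Manifold.
Context (R : realType) (n : nat) (M : topologicalType).

(* Only the restriction of cmap to cdom, and of cinv to the image cimg of cdom,
   is meaningful. *)
Record chart := Chart {
  cdom : set M;
  cmap : M -> 'rV[R]_n;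
  cinv : 'rV[R]_n -> M }.

Definition cimg (c : chart) : set 'rV[R]_n := cmap c @` cdom c.

Record is_chart (c : chart) : Prop := IsChart {
  chart_open_dom : open (cdom c);
  chart_open_img : open (cimg c);
  chartK : forall p, cdom c p -> cinv c (cmap c p) = p;
  chart_continuous : forall p, cdom c p -> {for p, continuous (cmap c)};
  chart_inv_continuous : forall x, cimg c x -> {for x, continuous (cinv c)} }.

(* Coordinate expression of f from the chart c to the chart c'. *)
Definition loc (f : M -> M) (c c' : chart) : 'rV[R]_n -> 'rV[R]_n :=
  fun x => cmap c' (f (cinv c x)).

Definition loc_dom (f : M -> M) (c c' : chart) : set 'rV[R]_n :=
  [set x | cimg c x /\ cdom c' (f (cinv c x))].

Definition compatible (c c' : chart) : Prop :=
  smooth_on (loc_dom id c c') (loc id c c') /\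
  smooth_on (loc_dom id c' c) (loc id c' c).

(* The atlas is maximal: its elements are all the local coordinate systems. *)
Record smooth_manifold (A : set chart) : Prop := SmoothManifold {
  mfd_hausdorff : hausdorff_space M;
  mfd_second_countable : @second_countable M;
  mfd_chart : forall c, A c -> is_chart c;
  mfd_cover : forall p : M, exists2 c, A c & cdom c p;
  mfd_compatible : forall c c', A c -> A c' -> compatible c c';
  mfd_maximal : forall c, is_chart c ->
    (forall c', A c' -> compatible c c') -> A c }.

Definition smooth_map (A : set chart) (f : M -> M) : Prop :=
  continuous f /\
  forall c c', A c -> A c' -> smooth_on (loc_dom f c c') (loc f c c').

(* A field is given by its components in every chart.  Invariance under a map f
   compares the components along the coordinate expression of f, whose
   differential at x is y |-> 'D_y (loc f c c') x; invariance under the identity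
   is the transformation law under changes of coordinates. *)

Definition vfield := chart -> 'rV[R]_n -> 'rV[R]_n.
Definition covfield := chart -> 'rV[R]_n -> 'rV[R]_n.
Definition bilfield := chart -> 'rV[R]_n -> 'M[R]_n.
(* F c x y is the value of F at the tangent vector with coordinates (x, y). *)
Definition tfunction := chart -> 'rV[R]_n -> 'rV[R]_n -> R.

Definition inner (a : bilfield) c (x y z : 'rV[R]_n) : R :=
  (y *m a c x *m z^T) 0 0.

Definition norm_of (a : bilfield) : tfunction :=
  fun c x y => Num.sqrt (inner a c x y y).

Definition eval_form (beta : covfield) : tfunction :=
  fun c x y => (beta c x *m y^T) 0 0.

Definition vfield_invariant (A : set chart) (f : M -> M) (X : vfield) : Prop :=
  forall c c', A c -> A c' -> forall x, loc_dom f c c' x ->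
    X c' (loc f c c' x) = 'D_(X c x) (loc f c c') x.

Definition tfunction_invariant (A : set chart) (f : M -> M) (F : tfunction) :
    Prop :=
  forall c c', A c -> A c' -> forall x, loc_dom f c c' x -> forall y,
    F c' (loc f c c' x) ('D_y (loc f c c') x) = F c x y.

Definition bilfield_invariant (A : set chart) (f : M -> M) (a : bilfield) :
    Prop :=
  forall c c', A c -> A c' -> forall x, loc_dom f c c' x -> forall y z,
    inner a c' (loc f c c' x) ('D_y (loc f c c') x) ('D_z (loc f c c') x)
    = inner a c x y z.

Definition is_vfield (A : set chart) (X : vfield) : Prop :=
  (forall c, A c -> smooth_on (cimg c) (X c)) /\ vfield_invariant A id X.

Definition is_oneform (A : set chart) (beta : covfield) : Prop :=
  (forall c, A c -> smooth_on (cimg c) (beta c)) /\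
  tfunction_invariant A id (eval_form beta).

Definition posdefmx (B : 'M[R]_n) : Prop :=
  forall v : 'rV[R]_n, v != 0 -> 0 < (v *m B *m v^T) 0 0.

Record riemannian_metric (A : set chart) (a : bilfield) : Prop :=
  RiemannianMetric {
    riem_smooth : forall c, A c -> smooth_on (cimg c) (a c);
    riem_sym : forall c x, A c -> cimg c x -> (a c x)^T = a c x;
    riem_posdef : forall c x, A c -> cimg c x -> posdefmx (a c x);
    riem_tensor : bilfield_invariant A id a }.

(* The norm sqrt (a^{ij} beta_i beta_j) of beta at x. *)
Definition form_norm (a : bilfield) (beta : covfield) c (x : 'rV[R]_n) : R :=
  Num.sqrt ((beta c x *m invmx (a c x) *m (beta c x)^T) 0 0).

Definition bracket (X Y : vfield) : vfield :=
  fun c x => 'D_(X c x) (Y c) x - 'D_(Y c x) (X c) x.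

Definition dvec (i : 'I_n) : 'rV[R]_n := delta_mx 0 i.

(* g_ij = 1/2 [F^2]_{y^i y^j} *)
Definition fundamental_tensor (F : tfunction) c (x y : 'rV[R]_n) : 'M[R]_n :=
  \matrix_(i, j) (2^-1 *
    'D_(dvec i) (fun u => 'D_(dvec j) (fun w => F c x w ^+ 2) u) y).

Record finsler_metric (A : set chart) (F : tfunction) : Prop := FinslerMetric {
  finsler_tangent : tfunction_invariant A id F;
  finsler_smooth : forall c, A c ->
    smooth_on [set p : 'rV[R]_n * 'rV[R]_n | cimg c p.1 /\ p.2 != 0]
      (fun p => F c p.1 p.2);
  finsler_pos : forall c x y, A c -> cimg c x -> y != 0 -> 0 < F c x y;
  finsler_homog : forall c x y (l : R), A c -> cimg c x -> 0 < l ->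
    F c x (l *: y) = l * F c x y;
  finsler_convex : forall c x y, A c -> cimg c x -> y != 0 ->
    posdefmx (fundamental_tensor F c x y) }.

(* G^i = 1/4 g^{il} ([F^2]_{x^m y^l} y^m - [F^2]_{x^l}) *)
Definition spray (F : tfunction) c (x y : 'rV[R]_n) (i : 'I_n) : R :=
  4^-1 * \sum_(l < n) invmx (fundamental_tensor F c x y) i l *
    (\sum_(m < n)
        'D_(dvec l) (fun w => 'D_(dvec m) (fun u => F c u w ^+ 2) x) y * y 0 m
     - 'D_(dvec l) (fun u => F c u y ^+ 2) x).

Definition douglas (A : set chart) (F : tfunction) : Prop :=
  forall c, A c ->
  exists (Gamma : 'I_n -> 'I_n -> 'I_n -> 'rV[R]_n -> R)
         (P : 'rV[R]_n -> 'rV[R]_n -> R),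
    (forall x y (l : R), cimg c x -> y != 0 -> 0 < l ->
       P x (l *: y) = l * P x y) /\
    (forall x y i, cimg c x -> y != 0 ->
       spray F c x y i =
         2^-1 * (\sum_(j < n) \sum_(k < n) Gamma i j k x * y 0 j * y 0 k)
         + P x y * y 0 i).

Definition is_riemannian (A : set chart) (F : tfunction) : Prop :=
  exists2 a, riemannian_metric A a &
    forall c x y, A c -> cimg c x -> F c x y = norm_of a c x y.

Definition randers (A : set chart) (F : tfunction) : Prop :=
  finsler_metric A F /\
  exists (a : bilfield) (beta : covfield),
    [/\ riemannian_metric A a, is_oneform A beta,
        forall c x, A c -> cimg c x -> form_norm a beta c x < 1 &
        forall c x y, A c -> cimg c x ->
          F c x y = norm_of a c x y + eval_form beta c x y].

Record alpha_beta_function (b0 : R) (phi : R -> R) : Prop :=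
  AlphaBetaFunction {
    abf_b0 : 0 < b0;
    abf_smooth : smooth_on `]- b0, b0[ phi;
    abf_pos : forall s : R, - b0 < s < b0 -> 0 < phi s;
    abf_convex : forall s b : R, `|s| <= b -> b < b0 ->
      0 < phi s - s * derive1 phi s + (b ^+ 2 - s ^+ 2) * derive1 (derive1 phi) s }.

Definition alpha_beta_metric (A : set chart) (a : bilfield) (X : vfield)
    (F : tfunction) : Prop :=
  finsler_metric A F /\
  exists (b0 : R) (phi : R -> R) (beta : covfield),
    [/\ alpha_beta_function b0 phi,
        is_oneform A beta,
        forall c x y, A c -> cimg c x -> eval_form beta c x y = inner a c x y (X c x),
        forall c x, A c -> cimg c x -> form_norm a beta c x < b0 &
        forall c x y, A c -> cimg c x ->
          F c x y = norm_of a c x y * phi (eval_form beta c x y / norm_of a c x y)].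

End Manifold.

Section LieGroup.
Context (R : realType) (n : nat) (G : groupTopologicalType).
Implicit Type A : set (chart R n G).

Record lie_group A : Prop := LieGroup {
  lie_manifold : smooth_manifold A;
  lie_mul_continuous : continuous (fun p : G * G => (p.1 * p.2)%g);
  lie_mul_smooth : forall c1 c2 c3, A c1 -> A c2 -> A c3 ->
    smooth_on
      [set p : 'rV[R]_n * 'rV[R]_n | [/\ cimg c1 p.1, cimg c2 p.2 &
         cdom c3 (cinv c1 p.1 * cinv c2 p.2)%g]]
      (fun p => cmap c3 (cinv c1 p.1 * cinv c2 p.2)%g);
  lie_inv_smooth : smooth_map A (fun p : G => (p^-1)%g) }.

Definition left_invariant_vfield A (X : vfield R n G) : Prop :=
  is_vfield A X /\ forall g : G, vfield_invariant A (fun p => g * p)%g X.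

Definition left_invariant_riemannian A (a : bilfield R n G) : Prop :=
  riemannian_metric A a /\
  forall g : G, bilfield_invariant A (fun p => g * p)%g a.

Definition left_invariant_tfunction A (F : tfunction R n G) : Prop :=
  forall g : G, tfunction_invariant A (fun p => g * p)%g F.

Definition orthonormal_frame A (a : bilfield R n G) (E : 'I_n -> vfield R n G) :
    Prop :=
  forall c x i j, A c -> cimg c x -> inner a c x (E i c x) (E j c x) = (i == j)%:R.

End LieGroup.

(* Coefficients of [E_i, E_j], for 1 <= i < j <= 5, on E_1, ..., E_5. *)
Definition l55_coef (R : realType) (a b c d e : R) (i j : nat) : seq R :=
  match i, j with
  | 1, 2 => [:: 0; 0; 0; a; b]
  | 1, 3 => [:: 0; 0; 0; 0; c]
  | 1, 4 => [:: 0; 0; 0; 0; d]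
  | 2, 3 => [:: 0; 0; 0; 0; e]
  | _, _ => [:: 0; 0; 0; 0; 0]
  end.

(* E_1, ..., E_5 are indexed by 'I_5, hence the shift of indices. *)
Definition l55_brackets (R : realType) (G : topologicalType)
    (A : set (chart R 5 G)) (E : 'I_5 -> vfield R 5 G) (a b c d e : R) : Prop :=
  forall (i j : 'I_5), (i < j)%N -> forall ch x, A ch -> cimg ch x ->
    bracket (E i) (E j) ch x
    = \sum_(k < 5) (l55_coef a b c d e i.+1 j.+1)`_k *: E k ch x.

(* Main.v *)
Require Import Defs.
From HB Require Import structures.
From mathcomp Require Import all_boot all_order all_algebra.
From mathcomp Require Import all_classical all_reals all_analysis.
From mathcomp Require Import ring lra.
Import Order.TTheory GRing.Theory Num.Theory.
Import numFieldNormedType.Exports.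
Local Open Scope classical_set_scope.
Local Open Scope ring_scope.

(** Fix a chart and a point x, and read tangent vectors in the left-invariant
    orthonormal frame: z is the row of coordinates of y.  There F^2/2 is a
    function L of z alone, depending on |z| and on <X, z>, with X a constant
    vector; its first and second differentials at z are [denergy] and [hess].
    Differentiating F^2 in x only brings in the derivative of the frame, whose
    skew part is the Lie bracket.  Since the Hessian of L is invertible, the
    definition of the spray becomes the statement [spray_hess], and for a
    Douglas metric ([douglas_frame])

      Hess L_z (B(z,z) + rho z, q) = - dL_z ([z, q])   for all q,

    with B bilinear.  The unknown terms are then eliminated by testing this
    identity on well-chosen q, with s = <X, z> / |z|.

    - If q is orthogonal to z and X ([transversal_identity]), only the bilinear
      B survives on the left.  If v, w and X are pairwise orthogonal and
      <X, [v, w]> <> 0, then along two curves in the plane of X and v, mirror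
      images of each other, the part odd in v gives phi' = k s (phi - s phi').
    - If X is orthogonal to all brackets, take q = |z|^2 X - <X, z> z
      ([radial_identity]).  On the same curves, with v orthogonal to X and
      <v, [v, X]> <> 0, the part even in v expresses phi - s phi' through
      phi - s phi' + (|X|^2 - s^2) phi'' with coefficients quadratic in s, and
      letting s tend to |X| fixes one of the two coefficients.

    In both cases (1 + k s^2) phi'' = k (phi - s phi') for |s| < |X|, whose
    solutions are phi = c1 sqrt (1 + k s^2) + c2 s ([phi_solution]); the
    factor 1 + k s^2 stays positive because phi - s phi' never vanishes.
    The brackets of l_{5,5} provide v and w in the first case when X has a
    component on E_4 or E_5 ([nonclosed_pair]), and v in the second case
    otherwise ([closed_radial]).

    As |beta| <= |X| alpha, this gives F = c1 sqrt (alpha^2 + k beta^2)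
    + c2 beta everywhere, and positivity of F forces the norm of c2 beta for the
    new metric to be less than one ([randers_of_phi]). *)

Set Implicit Arguments.
Unset Strict Implicit.
Unset Printing Implicit Defensive.

(** * Calculus along a direction, and the energy of an (alpha, beta)-norm *)

Lemma derivable_is_derive1 {R : realType} (g : R -> R) s :
  derivable g s 1 -> is_derive s 1 g (derive1 g s).
Proof. by move=> dg; split; [exact: dg | rewrite derive1E]. Qed.

Section DirectionalDerivatives.
Context {R : realType} {V : normedModType R}.
Implicit Types (f g : V -> R) (x v : V).

(** Reduces a directional derivative to a derivative on the line, where the
    chain rule and the mean value theorem live. *)
Lemma is_derive1P {W : normedModType R} (f : V -> W) x v df :
  is_derive x v f df <-> is_derive (0 : R) 1 (fun h : R => f (h *: v + x)) df.
Proof.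
have E : 'D_v f x = 'D_1 (fun h : R => f (h *: v + x)) 0.
  rewrite /derive; set g1 := fun h => h^-1 *: _; set g2 := fun h => h^-1 *: _.
  suff -> : g1 = g2 by [].
  by rewrite funeqE /g1 /g2 => h /=; rewrite addr0 scale0r add0r [_%:A]mulr1.
split=> -[d <-]; split=> //; [exact: (derivable1P f x v).1 d | exact: (derivable1P f x v).2 d].
Qed.

Lemma is_derive_comp1 f (g : R -> R) x v a b :
  is_derive (f x) 1 g a -> is_derive x v f b -> is_derive x v (g \o f) (a * b).
Proof.
move=> dg /is_derive1P df; apply/is_derive1P.
apply: (@is_derive1_comp _ g (fun h => f (h *: v + x))) => //.
by rewrite scale0r add0r.
Qed.

Lemma is_deriveMf f g x v df dg : is_derive x v f df -> is_derive x v g dg ->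
  is_derive x v (fun y => f y * g y) (df * g x + f x * dg).
Proof.
move=> hf hg; apply: is_derive_eq (is_deriveM hf hg) _.
by rewrite addrC /GRing.scale /= [g x * _]mulrC.
Qed.

Lemma is_deriveDf {W : normedModType R} (f g : V -> W) x v df dg :
  is_derive x v f df -> is_derive x v g dg ->
  is_derive x v (fun y => f y + g y) (df + dg).
Proof. by move=> hf hg; exact: is_deriveD. Qed.

Lemma is_derive_mxP m n (M : V -> 'M[R]_(m, n)) x v dM :
  is_derive x v M dM <->
  forall i j, is_derive x v (fun y => M y i j) (dM i j).
Proof.
split=> [[dM1 <-] i j|h].
  by split; [exact/(derivable_mxP M x v).1|rewrite derive_mx // mxE].
have d : derivable M x v by apply/derivable_mxP => i j; case: (h i j).
by split=> //; rewrite derive_mx //; apply/matrixP => i j; rewrite mxE; case: (h i j).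
Qed.

Lemma is_derive_mulmx m n p (M : V -> 'M[R]_(m, n)) (N : V -> 'M[R]_(n, p))
    x v dM dN :
  is_derive x v M dM -> is_derive x v N dN ->
  is_derive x v (fun y => M y *m N y) (dM *m N x + M x *m dN).
Proof.
move=> /is_derive_mxP hM /is_derive_mxP hN; apply/is_derive_mxP => i j.
rewrite (_ : (fun y => _) = \sum_k (fun y => M y i k * N y k j)); last first.
  by apply/funext => y; rewrite mxE fct_sumE.
have h := @is_derive_sum _ _ _ _ (fun k y => M y i k * N y k j) x v _
  (fun k => is_deriveMf (hM i k) (hN k j)).
apply: is_derive_eq h _.
by rewrite !mxE -big_split.
Qed.

Lemma is_derive_trmx m n (M : V -> 'M[R]_(m, n)) x v dM :
  is_derive x v M dM -> is_derive x v (fun y => (M y)^T) dM^T.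
Proof.
move=> /is_derive_mxP hM; apply/is_derive_mxP => i j.
by rewrite mxE; under eq_fun do rewrite mxE; exact: hM.
Qed.

Lemma is_deriveBf {W : normedModType R} (f g : V -> W) x v df dg :
  is_derive x v f df -> is_derive x v g dg ->
  is_derive x v (fun y => f y - g y) (df - dg).
Proof. by move=> hf hg; exact: is_deriveB. Qed.

Lemma is_deriveVf f x v df : is_derive x v f df -> f x != 0 ->
  is_derive x v (fun y => (f y)^-1) (- (f x) ^- 2 * df).
Proof. by move=> [d <-] f0; split; [exact: derivableV|exact: deriveV]. Qed.

Lemma is_derive_cstf {W : normedModType R} (a : W) x v : is_derive x v (fun=> a) 0.
Proof. exact: is_derive_cst. Qed.

End DirectionalDerivatives.

Section Dot.
Context {R : realType} {n : nat}.
Implicit Types (u v w : 'rV[R]_n) (a : R).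

Definition dot u v : R := (u *m v^T) 0 0.

Lemma dotC u v : dot u v = dot v u.
Proof. by rewrite /dot -[v *m u^T]trmxK trmx_mul trmxK [RHS]mxE. Qed.
Lemma dotDl u v w : dot (u + v) w = dot u w + dot v w.
Proof. by rewrite /dot mulmxDl mxE. Qed.
Lemma dotDr u v w : dot w (u + v) = dot w u + dot w v.
Proof. by rewrite dotC dotDl !(dotC w). Qed.
Lemma dotZl a u v : dot (a *: u) v = a * dot u v.
Proof. by rewrite /dot -scalemxAl mxE. Qed.
Lemma dotZr a u v : dot v (a *: u) = a * dot v u.
Proof. by rewrite dotC dotZl dotC. Qed.
Lemma dotNl u v : dot (- u) v = - dot u v.
Proof. by rewrite -scaleN1r dotZl mulN1r. Qed.
Lemma dotNr u v : dot v (- u) = - dot v u.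
Proof. by rewrite dotC dotNl dotC. Qed.
Lemma dotBr u v w : dot w (u - v) = dot w u - dot w v.
Proof. by rewrite dotDr dotNr. Qed.
Lemma dotBl u v w : dot (u - v) w = dot u w - dot v w.
Proof. by rewrite dotDl dotNl. Qed.
Lemma dot0r u : dot u 0 = 0.
Proof. by rewrite -(scale0r 0) dotZr mul0r. Qed.
Lemma dot0l u : dot 0 u = 0. Proof. by rewrite dotC dot0r. Qed.

Lemma dotE u v : dot u v = \sum_i u 0 i * v 0 i.
Proof. by rewrite /dot mxE; apply: eq_bigr => i _; rewrite mxE. Qed.

Lemma dot_ge0 u : 0 <= dot u u.
Proof. by rewrite dotE sumr_ge0 // => i _; rewrite -expr2 sqr_ge0. Qed.

Lemma dot_eq0 u : (dot u u == 0) = (u == 0).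
Proof.
apply/idP/eqP => [|->]; last by rewrite dot0r.
rewrite dotE psumr_eq0; last by move=> i _; rewrite -expr2 sqr_ge0.
move=> /allP h; apply/rowP => i; rewrite mxE.
by have := h i (mem_index_enum i); rewrite -expr2 sqrf_eq0 => /eqP.
Qed.

Lemma dot_gt0 u : (0 < dot u u) = (u != 0).
Proof. by rewrite lt0r dot_ge0 andbT dot_eq0. Qed.

Lemma is_derive_dot {V : normedModType R} (f g : V -> 'rV[R]_n) (x v : V) df dg :
  is_derive x v f df -> is_derive x v g dg ->
  is_derive x v (fun y => dot (f y) (g y)) (dot df (g x) + dot (f x) dg).
Proof.
move=> hf hg.
have /is_derive_mxP /(_ 0 0) h := is_derive_mulmx hf (is_derive_trmx hg).
by apply: is_derive_eq h _; rewrite mxE.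
Qed.

End Dot.

Section AlphaBetaNorm.
Context {R : realType} {n : nat}.
Variables (phi : R -> R) (X : 'rV[R]_n).
Implicit Types (z p q : 'rV[R]_n).

Definition dotnorm z := Num.sqrt (dot z z).
Definition slope z := dot X z / dotnorm z.
Definition psi s := phi s - s * derive1 phi s.

(** The differential at z, applied to p, of L = (dotnorm z * phi (slope z))^2 / 2;
    see [is_derive_sqr_norm]. *)
Definition denergy z p :=
  phi (slope z) * psi (slope z) * dot z p
  + dotnorm z * (phi (slope z) * derive1 phi (slope z)) * dot X p.

Definition hcoef s := derive1 phi s ^+ 2 + phi s * derive1 (derive1 phi) s.
Definition kcoef s := phi s * derive1 phi s - s * hcoef s.

(** The second differential of L at z; see [is_derive_denergy]. *)
Definition hess z p q :=
  phi (slope z) * psi (slope z) * dot p q + hcoef (slope z) * dot X p * dot X q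
  + kcoef (slope z) * (dot X p * dot z q + dot z p * dot X q) / dotnorm z
  - slope z * kcoef (slope z) * dot z p * dot z q / dotnorm z ^+ 2.

Lemma dotnorm_gt0 z : z != 0 -> 0 < dotnorm z.
Proof. by move=> z0; rewrite sqrtr_gt0 dot_gt0. Qed.
Lemma sqr_dotnorm z : dotnorm z ^+ 2 = dot z z.
Proof. by rewrite sqr_sqrtr // dot_ge0. Qed.

Lemma hess_sym z p q : hess z p q = hess z q p.
Proof. rewrite /hess (dotC p q); ring. Qed.
Lemma hessDl z p p' q : hess z (p + p') q = hess z p q + hess z p' q.
Proof. rewrite /hess !dotDl !dotDr; ring. Qed.
Lemma hessZl z a p q : hess z (a *: p) q = a * hess z p q.
Proof. rewrite /hess !dotZl !dotZr; ring. Qed.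
Lemma hessNl z p q : hess z (- p) q = - hess z p q.
Proof. by rewrite -scaleN1r hessZl mulN1r. Qed.
Lemma hess0l z q : hess z 0 q = 0.
Proof. by rewrite -(scale0r 0) hessZl mul0r. Qed.
Lemma hess_suml z m (f : 'I_m -> 'rV[R]_n) q :
  hess z (\sum_i f i) q = \sum_i hess z (f i) q.
Proof.
elim/big_ind2 : _ => [|p a p' b <- <-|//]; first exact: hess0l.
by rewrite hessDl.
Qed.
Lemma denergyD z p q : denergy z (p + q) = denergy z p + denergy z q.
Proof. rewrite /denergy !dotDr; ring. Qed.
Lemma denergyZ z a q : denergy z (a *: q) = a * denergy z q.
Proof. rewrite /denergy !dotZr; ring. Qed.
Lemma denergyN z q : denergy z (- q) = - denergy z q.
Proof. by rewrite -scaleN1r denergyZ mulN1r. Qed.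
Lemma denergy0 z : denergy z 0 = 0.
Proof. by rewrite -(scale0r 0) denergyZ mul0r. Qed.
Lemma denergy_sum z m (f : 'I_m -> 'rV[R]_n) : denergy z (\sum_i f i) = \sum_i denergy z (f i).
Proof.
elim/big_ind2 : _ => [|p a p' b <- <-|//]; first exact: denergy0.
by rewrite denergyD.
Qed.

Section Derivatives.
Context {V : normedModType R} (zeta eta : V -> 'rV[R]_n) (x v : V) (dz de : 'rV[R]_n).
Hypotheses (hz : is_derive x v zeta dz) (z0 : zeta x != 0).
Local Notation z := (zeta x).

Let a0 : dotnorm z != 0. Proof. by rewrite gt_eqF // dotnorm_gt0. Qed.

Lemma is_derive_dotnorm : is_derive x v (dotnorm \o zeta) (dot z dz / dotnorm z).
Proof.
have h := is_derive_dot hz hz.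
have s0 : 0 < dot z z by rewrite dot_gt0.
have h' := @is_derive_comp1 _ _ (fun y => dot (zeta y) (zeta y)) _ _ _ _ _
  (is_derive1_sqrt s0) h.
apply: is_derive_eq h' _.
by rewrite -/(dotnorm z) (dotC dz); field.
Qed.

Lemma is_derive_slope :
  is_derive x v (slope \o zeta) ((dot X dz - slope z * dot z dz / dotnorm z) / dotnorm z).
Proof.
have hX := is_derive_dot (is_derive_cstf X x v) hz.
have ha := is_derive_dotnorm.
have hinv := is_deriveVf ha a0.
apply: is_derive_eq (is_deriveMf hX hinv) _.
by rewrite dot0l /slope /=; move: a0 => a0'; field.
Qed.

Hypothesis dphi : derivable phi (slope z) 1.

Lemma is_derive_phi_slope :
  is_derive x v (phi \o slope \o zeta)
    (derive1 phi (slope z) * ((dot X dz - slope z * dot z dz / dotnorm z) / dotnorm z)).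
Proof.
apply: (@is_derive_comp1 _ _ (slope \o zeta) phi _ _ _ _ _ is_derive_slope).
exact: derivable_is_derive1 dphi.
Qed.

Lemma is_derive_sqr_norm :
  is_derive x v (fun y => (dotnorm (zeta y) * phi (slope (zeta y))) ^+ 2) (2 * denergy z dz).
Proof.
have h := is_deriveMf is_derive_dotnorm is_derive_phi_slope.
apply: is_derive_eq (is_deriveMf h h) _.
rewrite /denergy /psi /=; move: a0 => a0'; by field.
Qed.

Hypothesis dphi' : derivable (derive1 phi) (slope z) 1.
Hypothesis he : is_derive x v eta de.

Lemma is_derive_denergy :
  is_derive x v (fun y => denergy (zeta y) (eta y)) (hess z (eta x) dz + denergy z de).
Proof.
have hs := is_derive_slope; have ha := is_derive_dotnorm; have hp := is_derive_phi_slope.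
have hp' : is_derive x v (derive1 phi \o slope \o zeta)
    (derive1 (derive1 phi) (slope z) * ((dot X dz - slope z * dot z dz / dotnorm z) / dotnorm z)).
  apply: (@is_derive_comp1 _ _ (slope \o zeta) (derive1 phi) _ _ _ _ _ hs).
  exact: derivable_is_derive1 dphi'.
have hpsi := is_deriveBf hp (is_deriveMf hs hp').
have h1 := is_deriveMf (is_deriveMf hp hpsi) (is_derive_dot hz he).
have hX := is_derive_dot (is_derive_cstf X x v) he.
have h2 := is_deriveMf (is_deriveMf ha (is_deriveMf hp hp')) hX.
apply: is_derive_eq (is_deriveDf h1 h2) _.
rewrite /hess /denergy /kcoef /hcoef /psi /= dot0l (dotC dz (eta x)) add0r.
move: (derive1 (derive1 phi) _) (derive1 phi _) (phi _) a0 => p2 p1 p0.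
move: (slope z) (dotnorm z) (dot X dz) (dot z dz) (dot X (eta x)) (dot z (eta x)).
move: (dot X de) (dot z de) (dot (eta x) dz) => d1 d2 d3 s a d4 d5 d6 d7 a0'.
by field.
Qed.
End Derivatives.

End AlphaBetaNorm.

(** * Additivity of directional derivatives of functions of class C^1 *)

Section DirectionalLinearity.
Context {R : realType} {V : normedModType R}.
Implicit Types (f : V -> R) (x v w : V) (U : set V).

(** Homogeneity in the direction; [is_deriveDdir] adds directions. *)
Lemma is_deriveZdir f x v a d : is_derive x v f d -> is_derive x (a *: v) f (a * d).
Proof.
move=> /is_derive1P df; apply/is_derive1P.
have hl : is_derive (0 : R) 1 (fun h : R => h * a) a.
  apply: is_derive_eq (is_deriveMf (is_derive_id _ _) (is_derive_cstf a _ _)) _.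
  by rewrite mul1r mulr0 addr0.
rewrite -(mul0r a) in df.
apply: is_derive_eq.
  have -> : (fun h : R => f (h *: (a *: v) + x)) =
    (fun h : R => f (h *: v + x)) \o (fun h => h * a).
    by apply/funext => h /=; rewrite scalerA.
  exact: (@is_derive1_comp _ (fun h : R => f (h *: v + x)) (fun h => h * a) 0 d a df hl).
by rewrite mulrC.
Qed.

(** The mean value theorem on the segment from y to y + h w, in a form which does
    not depend on the sign of h. *)
Lemma increment_dir f w y (h : R) :
  (forall t : R, 0 <= t <= 1 -> derivable f (t *: (h *: w) + y) w) ->
  exists2 t : R, 0 <= t <= 1 & f (h *: w + y) - f y = h * 'D_w f (t *: (h *: w) + y).
Proof.
move=> df.
pose k (t : R) := f (t *: (h *: w) + y).
have dk (t : R) : 0 <= t <= 1 -> is_derive t 1 k (h * 'D_w f (t *: (h *: w) + y)).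
  move=> /df /derivableP /(@is_deriveZdir _ _ _ h) /is_derive1P dh; apply/is_derive1P.
  have -> : (fun s : R => k (s *: 1 + t))
    = (fun s : R => f (s *: (h *: w) + (t *: (h *: w) + y))).
    by apply/funext => s; rewrite /k [s *: 1]mulr1 scalerDl addrA.
  exact: dh.
have ck : {within `[0, 1], continuous k}.
  by apply: derivable_within_continuous => t; rewrite in_itv => /dk [].
have dk' (t : R) : t \in `]0, 1[ -> is_derive t 1 k (h * 'D_w f (t *: (h *: w) + y)).
  by rewrite in_itv /= => /andP[t0 t1]; apply: dk; rewrite !ltW.
have [t] := MVT ltr01 dk' ck.
rewrite in_itv /= => /andP[t0 t1]; rewrite subr0 mulr1 /k scale1r scale0r add0r => E.
by exists t; rewrite ?E // !ltW.
Qed.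

(** The increment along v + w is the increment along v followed by one along w at
    a moving base point.  By the mean value theorem the latter is a value of 'D_w f
    near x, so its continuity at x suffices. *)
Lemma is_deriveDdir f U x v w d : open U -> U x ->
  (forall y, U y -> derivable f y w) -> {for x, continuous ('D_w f)} ->
  is_derive x v f d -> is_derive x (v + w) f (d + 'D_w f x).
Proof.
move=> oU Ux dw cw [dv <-].
suff cv : (fun h => h^-1 *: ((f \o shift x) (h *: (v + w)) - f x)) @ 0^'
    --> 'D_v f x + 'D_w f x.
  by split; [apply/cvg_ex; exists ('D_v f x + 'D_w f x)|exact: cvg_lim cv].
have -> : (fun h => h^-1 *: ((f \o shift x) (h *: (v + w)) - f x)) =
  (fun h => h^-1 *: ((f \o shift x) (h *: v) - f x)
     + h^-1 *: (f (h *: w + (h *: v + x)) - f (h *: v + x))).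
  apply/funext => h /=; rewrite -scalerDr; congr (_ *: _).
  rewrite scalerDr [h *: v + h *: w]addrC -addrA; ring.
apply: cvgD; first exact: dv.
apply/cvgrPdist_le => /= e e0.
have /nbhs_ballP [r /= r0 rP] : nbhs x (U `&` [set y | `|'D_w f x - 'D_w f y| <= e]).
  apply: filterI; first exact: open_nbhs_nbhs.
  by move/cvgrPdist_le : cw => /(_ e e0).
pose C := `|v| + `|w| + 1.
have C0 : 0 < C by rewrite /C; have := normr_ge0 v; have := normr_ge0 w; lra.
near=> h.
have h0 : h != 0 by near: h; exact: nbhs_dnbhs_neq.
have hr : `|h| < r / C by near: h; apply: dnbhs0_lt; rewrite divr_gt0.
have inB (t : R) : 0 <= t <= 1 -> ball x r (t *: (h *: w) + (h *: v + x)).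
  move=> /andP[t0 t1]; rewrite -ball_normE /ball_ /=.
  rewrite opprD [h *: v + x]addrC opprD !addrA [x - _ - _]addrAC subrr sub0r.
  rewrite -opprD normrN (le_lt_trans (ler_normD _ _)) // !normrZ (ger0_norm t0).
  rewrite ltr_pdivlMr // in hr.
  apply: le_lt_trans hr; rewrite /C.
  have := normr_ge0 v; have := normr_ge0 w; have := normr_ge0 h.
  move: (`|h|) (`|v|) (`|w|) => H A B H0 B0 A0.
  have : t * (H * B) <= H * B by rewrite ler_piMl // mulr_ge0.
  nra.
have [|t t01 ->] := @increment_dir f w (h *: v + x) h.
  by move=> t /inB /rP [Ut _]; exact: dw.
rewrite [_ *: _]mulrA mulVf // mul1r.
by have /rP [] := inB _ t01.
Unshelve. all: by end_near. Qed.

End DirectionalLinearity.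

Section Coordinates.
Context {R : realType} {n : nat}.

(** The spray only involves the partial derivatives, whereas the brackets involve
    derivatives along the frame; this is the link between them. *)
Lemma is_derive_dvec p q (M : 'rV[R]_n -> 'M[R]_(p, q)) (U : set 'rV[R]_n) x y :
  open U -> U x -> Ck_on 1 U M ->
  is_derive x y M (\sum_m y 0 m *: 'D_(dvec R m) M x).
Proof.
move=> oU Ux [_ CM]; apply/is_derive_mxP => i j.
have dM v z : U z -> is_derive z v (fun u => M u i j) ('D_v M z i j).
  by move=> Uz; have /derivableP/is_derive_mxP := (CM v).1 _ Uz; exact.
have cM v : {for x, continuous ('D_v (fun u => M u i j))}.
  have E : {near x, (fun z => 'D_v M z i j) =1 'D_v (fun u => M u i j)}.
    near=> z; have Uz : U z by near: z; exact: open_nbhs_nbhs.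
    by have [_ ->] := dM v z Uz.
  have c : {for x, continuous (fun z => 'D_v M z i j)}.
    have [_ [cD _]] := CM v.
    apply: (@continuous_comp _ _ _ ('D_v M) (fun N => N i j)); first exact: cD.
    exact: coord_continuous.
  have := cvg_trans (near_eq_cvg E) c.
  by have := nbhs_singleton E => /= ->; exact.
rewrite {1}(row_sum_delta y) summxE.
elim/big_ind2 : _ => [|dv v dw w|m _].
- exact: is_derive0.
- move=> hv hw; have [_ <-] := hw.
  apply: (is_deriveDdir oU Ux) => //.
  by move=> z Uz; have [] := dM w z Uz.
- by rewrite mxE; apply: is_deriveZdir; exact: dM.
Unshelve. all: by end_near. Qed.

End Coordinates.

(** * The spray in a moving frame *)

Lemma posdefmx_unit {R : realType} n (g : 'M[R]_n) : posdefmx g -> g \in unitmx.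
Proof.
move=> pg; rewrite -row_free_unit -kermx_eq0; apply/eqP/row_matrixP => i.
rewrite row0; apply/eqP/negPn/negP => /pg.
have : row i (kermx g) *m g = 0.
  by apply/sub_kermxP; exact: row_sub.
by move=> ->; rewrite mul0mx mxE ltxx.
Qed.

Section SprayInFrame.
Context {R : realType} {n : nat} {M : topologicalType}.
Variables (c : chart R n M) (U : set 'rV[R]_n) (x : 'rV[R]_n).
Variables (F : tfunction R n M) (phi : R -> R) (X : 'rV[R]_n).
Variables (Th : 'rV[R]_n -> 'M[R]_n) (T : 'I_n -> 'M[R]_n).
Hypotheses (oU : open U) (Ux : U x).
Hypothesis FE : forall (u w : 'rV[R]_n), U u -> w != 0 ->
  F c u w = dotnorm (w *m Th u) * phi (slope X (w *m Th u)).
Hypothesis unitTh : Th x \in unitmx.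
Hypothesis dphi : forall z : 'rV[R]_n, z != 0 -> derivable phi (slope X z) 1.
Hypothesis dphi' : forall z : 'rV[R]_n, z != 0 -> derivable (derive1 phi) (slope X z) 1.

(** The differential of Th at x, as determined by its partial derivatives T. *)
Definition linear_ext (y : 'rV[R]_n) : 'M[R]_n := \sum_m y 0 m *: T m.
Hypothesis hTh : forall y : 'rV[R]_n, is_derive x y Th (linear_ext y).

Lemma linear_ext_linear : linear linear_ext.
Proof.
move=> a u v; rewrite /linear_ext scaler_sumr -big_split /=; apply: eq_bigr => m _.
by rewrite !mxE scalerDl scalerA.
Qed.

Lemma linear_ext_dvec m : linear_ext (dvec R m) = T m.
Proof.
rewrite /linear_ext (bigD1 m) //= mxE !eqxx scale1r big1 ?addr0 // => i im.
by rewrite mxE (negPf im) andbF scale0r.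
Qed.

Let near_neq0 (w : 'rV[R]_n) : w != 0 -> \forall y \near w, y != 0.
Proof.
move=> w0; near=> y; near: y; apply: cvgr_neq0; [exact: cvg_id|exact: w0].
Unshelve. all: by end_near. Qed.

Let mulTh_neq0 (w : 'rV[R]_n) : w != 0 -> w *m Th x != 0.
Proof.
by apply: contraNneq => wT; rewrite -(mulmxK unitTh w) wT mul0mx.
Qed.

Local Notation f l := (dvec R l *m Th x).

Lemma derive_F2_x (w : 'rV[R]_n) m : w != 0 ->
  'D_(dvec R m) (fun u => F c u w ^+ 2) x = 2 * denergy phi X (w *m Th x) (w *m T m).
Proof.
move=> w0.
have hz : is_derive x (dvec R m) (fun u => w *m Th u) (w *m T m).
  apply: is_derive_eq (is_derive_mulmx (is_derive_cstf w _ _) (hTh _)) _.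
  by rewrite mul0mx add0r linear_ext_dvec.
have z0 := mulTh_neq0 w0.
have [_ <-] := is_derive_sqr_norm hz z0 (dphi z0).
apply: near_eq_derive; near=> u.
by rewrite FE //; near: u; exact: open_nbhs_nbhs.
Unshelve. all: by end_near. Qed.

Let hmul (w v : 'rV[R]_n) : is_derive w v (fun u => u *m Th x) (v *m Th x).
Proof.
apply: is_derive_eq (is_derive_mulmx (is_derive_id _ _) (is_derive_cstf _ _ _)) _.
by rewrite mulmx0 addr0.
Qed.

Lemma derive_F2_y (w : 'rV[R]_n) l : w != 0 ->
  'D_(dvec R l) (fun u => F c x u ^+ 2) w = 2 * denergy phi X (w *m Th x) (f l).
Proof.
move=> w0; have z0 := mulTh_neq0 w0.
have [_ <-] := is_derive_sqr_norm (hmul w (dvec R l)) z0 (dphi z0).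
apply: near_eq_derive; near=> u.
by rewrite FE //; near: u; exact: near_neq0.
Unshelve. all: by end_near. Qed.

(** Both factors of denergy depend on w: the first term comes from moving the base
    point, the second one from moving the vector w *m T m. *)
Lemma derive_F2_xy (y : 'rV[R]_n) m l : y != 0 ->
  'D_(dvec R l) (fun w => 'D_(dvec R m) (fun u => F c u w ^+ 2) x) y =
  2 * (hess phi X (y *m Th x) (y *m T m) (f l) + denergy phi X (y *m Th x) (dvec R l *m T m)).
Proof.
move=> y0; have z0 := mulTh_neq0 y0.
have hT : is_derive y (dvec R l) (fun w => w *m T m) (dvec R l *m T m).
  apply: is_derive_eq (is_derive_mulmx (is_derive_id _ _) (is_derive_cstf _ _ _)) _.
  by rewrite mulmx0 addr0.
have h := is_derive_denergy (hmul y (dvec R l)) z0 (dphi z0) (dphi' z0) hT.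
have h2 := is_deriveMf (is_derive_cstf (2 : R) y (dvec R l)) h.
have [_] := h2; rewrite mul0r add0r => <-.
apply: near_eq_derive; near=> w.
by rewrite derive_F2_x //; near: w; exact: near_neq0.
Unshelve. all: by end_near. Qed.

Lemma fundamental_tensorE (y : 'rV[R]_n) i j : y != 0 ->
  fundamental_tensor F c x y i j = hess phi X (y *m Th x) (f i) (f j).
Proof.
move=> y0; have z0 := mulTh_neq0 y0.
rewrite mxE.
have h := is_derive_denergy (hmul y (dvec R i)) z0 (dphi z0) (dphi' z0)
  (is_derive_cstf (f j) y (dvec R i)).
have h2 := is_deriveMf (is_derive_cstf (2 : R) y (dvec R i)) h.
have -> : 'D_(dvec R i) (fun u => 'D_(dvec R j) (fun w => F c x w ^+ 2) u) y =
  'D_(dvec R i) (fun u => 2 * denergy phi X (u *m Th x) (f j)) y.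
  apply: near_eq_derive; near=> w.
  by rewrite derive_F2_y //; near: w; exact: near_neq0.
have [_ ->] := h2.
rewrite mul0r add0r denergy0 addr0 hess_sym.
by move: (hess _ _ _ _ _) => H; field.
Unshelve. all: by end_near. Qed.

(** With L as above and z the frame coordinates of y, the spray equation reads
    g(2 G, p) = D^2_{xy}(L) (y, p) - D_x(L) p, and the derivative of
    z = y *m Th along y contributes the quadratic term y *m linear_ext y. *)
Lemma spray_hess (y p : 'rV[R]_n) : y != 0 -> posdefmx (fundamental_tensor F c x y) ->
  let z := y *m Th x in
  hess phi X z (2 *: ((\row_i spray F c x y i) *m Th x) - y *m linear_ext y) (p *m Th x)
  = denergy phi X z (p *m linear_ext y - y *m linear_ext p).
Proof.
move=> y0 /posdefmx_unit ug z.
set g := fundamental_tensor F c x y in ug *.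
pose V l : R := 2 * (hess phi X z (y *m linear_ext y) (f l)
  + denergy phi X z (dvec R l *m linear_ext y - y *m T l)).
have VE l : \sum_(m < n) 'D_(dvec R l) (fun w => 'D_(dvec R m) (fun u => F c u w ^+ 2) x) y
      * y 0 m - 'D_(dvec R l) (fun u => F c u y ^+ 2) x = V l.
  rewrite derive_F2_x // /V denergyD denergyN.
  under eq_bigr do rewrite derive_F2_xy //.
  rewrite /linear_ext !mulmx_sumr hess_suml denergy_sum addrA [in RHS]mulrBr.
  congr (_ - _); rewrite -big_split mulr_sumr /=; apply: eq_bigr => m _.
  by rewrite -!scalemxAr hessZl denergyZ; ring.
pose G := \row_i spray F c x y i.
have GE : g *m G^T = 4^-1 *: \col_l V l.
  have -> : G^T = 4^-1 *: (invmx g *m \col_l V l).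
    apply/colP => i; rewrite !mxE /spray -/g; congr (_ * _).
    by apply: eq_bigr => l _; rewrite VE mxE.
  by rewrite -scalemxAr mulKVmx.
have Gl l : 2 * hess phi X z (G *m Th x) (f l) = hess phi X z (y *m linear_ext y) (f l)
  + denergy phi X z (dvec R l *m linear_ext y - y *m T l).
  have /colP /(_ l) := GE; rewrite !mxE => E.
  have -> : hess phi X z (G *m Th x) (f l) = 4^-1 * V l.
    rewrite -E {1}(row_sum_delta G) mulmx_suml hess_suml; apply: eq_bigr => i _.
    rewrite -scalemxAl hessZl mulrC /g fundamental_tensorE // [in RHS]hess_sym.
    by rewrite [in RHS]mxE.
  by rewrite /V; move: (hess _ _ _ _ _) (denergy _ _ _ _) => H D; field.
rewrite (row_sum_delta p) mulmx_suml hess_sym hess_suml.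
rewrite (_ : _ *m linear_ext y - _ = \sum_l p 0 l *: (dvec R l *m linear_ext y - y *m T l)); last first.
  rewrite {2}/linear_ext mulmx_suml mulmx_sumr -sumrB; apply: eq_bigr => l _.
  by rewrite scalerBr scalemxAl -scalemxAr -row_sum_delta.
rewrite denergy_sum; apply: eq_bigr => l _.
rewrite -scalemxAl hessZl denergyZ hess_sym; congr (_ * _).
by rewrite hessDl hessZl Gl hessNl; ring.
Qed.

End SprayInFrame.

(** * The Douglas condition as an identity on the Lie algebra *)

Definition lie_bracket {R : realType} {n} (C : 'I_n -> 'I_n -> 'rV[R]_n) (z q : 'rV[R]_n) :=
  \sum_i \sum_j (z 0 i * q 0 j) *: C i j.

Section DouglasInFrame.
Context {R : realType} {n : nat} {M : topologicalType}.
Variables (c : chart R n M) (U : set 'rV[R]_n) (x : 'rV[R]_n).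
Variables (F : tfunction R n M) (phi : R -> R) (X : 'rV[R]_n).
Variables (Em Th : 'rV[R]_n -> 'M[R]_n) (T : 'I_n -> 'M[R]_n).
Variable (C : 'I_n -> 'I_n -> 'rV[R]_n).
Hypotheses (oU : open U) (Ux : U x).
Hypothesis FE : forall u w : 'rV[R]_n, U u -> w != 0 ->
  F c u w = dotnorm (w *m Th u) * phi (slope X (w *m Th u)).
Hypothesis ETh : forall u, U u -> Em u *m Th u = 1%:M.
Hypothesis dphi : forall z : 'rV[R]_n, z != 0 -> derivable phi (slope X z) 1.
Hypothesis dphi' : forall z : 'rV[R]_n, z != 0 ->
  derivable (derive1 phi) (slope X z) 1.
Hypothesis hTh : forall y : 'rV[R]_n, is_derive x y Th (linear_ext T y).
Hypothesis dEm : forall y : 'rV[R]_n, derivable Em x y.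
Hypothesis hC : forall i j, 
  row j ('D_(row i (Em x)) Em x) - row i ('D_(row j (Em x)) Em x) = C i j *m Em x.
Hypothesis posF : forall y : 'rV[R]_n, y != 0 ->
  posdefmx (fundamental_tensor F c x y).
Variables (Gam : 'I_n -> 'I_n -> 'I_n -> R) (P : 'rV[R]_n -> R).
Hypothesis douglasE : forall (y : 'rV[R]_n) i, y != 0 ->
  spray F c x y i = 2^-1 * (\sum_j \sum_k Gam i j k * y 0 j * y 0 k) + P y * y 0 i.

Let TTh : Th x *m Em x = 1%:M.
Proof. exact/mulmx1C/ETh. Qed.

Let unitTh : Th x \in unitmx.
Proof. by have [] := mulmx1_unit TTh. Qed.

Lemma linear_ext_mulmx m (z : 'rV[R]_m) (E : 'M[R]_(m, n)) :
  linear_ext T (z *m E) = \sum_i z 0 i *: linear_ext T (row i E).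
Proof.
rewrite /linear_ext; under [RHS]eq_bigr do rewrite scaler_sumr.
rewrite exchange_big; apply: eq_bigr => m' _; rewrite mxE scaler_suml.
by apply: eq_bigr => i _; rewrite mxE scalerA.
Qed.

(** Differentiating Em *m Th = 1. *)
Lemma derive_frame (y : 'rV[R]_n) : 'D_y Em x *m Th x = - (Em x *m linear_ext T y).
Proof.
have h := is_derive_mulmx (derivableP (@dEm y)) (hTh y).
have h1 : is_derive x y (fun u => Em u *m Th u) 0.
  apply: near_eq_is_derive (is_derive_cstf (1%:M : 'M[R]_n) x y).
  by near=> u; rewrite ETh //; near: u; exact: open_nbhs_nbhs.
have [_ e1] := h; have [_ e2] := h1.
by apply/eqP; rewrite -addr_eq0 -e1 e2.
Unshelve. all: by end_near. Qed.

(** The structure equation d theta (Y, Z) = - theta ([Y, Z]), valid for any two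
    combinations of the frame with constant coefficients. *)
Lemma bracket_coframe (z q : 'rV[R]_n) :
  (q *m Em x) *m linear_ext T (z *m Em x) - (z *m Em x) *m linear_ext T (q *m Em x) = - lie_bracket C z q.
Proof.
have expand (u v : 'rV[R]_n) : (u *m Em x) *m linear_ext T (v *m Em x) =
    \sum_i \sum_j (v 0 i * u 0 j) *: (row j (Em x) *m linear_ext T (row i (Em x))).
  rewrite linear_ext_mulmx mulmx_sumr; apply: eq_bigr => i _.
  rewrite -scalemxAr {1}(row_sum_delta u) !mulmx_suml scaler_sumr.
  by apply: eq_bigr => j _; rewrite -!scalemxAl scalerA -rowE.
rewrite !expand /lie_bracket [X in _ - X]exchange_big -sumrB -sumrN; apply: eq_bigr => i _.
rewrite -sumrB -sumrN; apply: eq_bigr => j _.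
rewrite [q 0 j * _]mulrC -scalerBr -scalerN; congr (_ *: _).
have -> : C i j = (C i j *m Em x) *m Th x by rewrite -mulmxA ETh // mulmx1.
rewrite -hC mulmxBl -!row_mul !derive_frame !rowE !mulmxN !mulmxA.
by rewrite opprK opprD opprK.
Qed.

(** In frame coordinates the Douglas form of the spray is quadratic modulo z; the
    term z *m linear_ext z of [spray_hess] is quadratic as well. *)
Theorem douglas_frame : exists B : 'rV[R]_n -> 'rV[R]_n -> 'rV[R]_n,
  [/\ forall w, linear (B w), forall w, linear (B^~ w) &
   forall z : 'rV[R]_n, z != 0 -> exists rho, forall q,
    hess phi X z (B z z + rho *: z) q = - denergy phi X z (lie_bracket C z q)].
Proof.
pose G (y w : 'rV[R]_n) := \row_i (\sum_j \sum_k Gam i j k * y 0 j * w 0 k).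
have Gl w : linear (G w).
  move=> a u v; apply/rowP => i; rewrite !mxE mulr_sumr -big_split.
  apply: eq_bigr => j _; rewrite mulr_sumr -big_split; apply: eq_bigr => k _.
  by rewrite !mxE /=; ring.
have Gr w : linear (G^~ w).
  move=> a u v; apply/rowP => i; rewrite !mxE mulr_sumr -big_split.
  apply: eq_bigr => j _; rewrite mulr_sumr -big_split; apply: eq_bigr => k _.
  by rewrite !mxE /=; ring.
exists (fun z w => G (z *m Em x) (w *m Em x) *m Th x
  - (z *m Em x) *m linear_ext T (w *m Em x)); split.
- move=> w a u v; rewrite mulmxDl -scalemxAl Gl linear_ext_linear.
  rewrite mulmxDl mulmxDr -scalemxAl -scalemxAr scalerBr.
  by rewrite opprD addrACA.
- move=> w a u v; rewrite mulmxDl -scalemxAl Gr.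
  rewrite !mulmxDl -!scalemxAl scalerBr.
  by rewrite opprD addrACA.
move=> z z0; set y := z *m Em x.
have yT : y *m Th x = z by rewrite -mulmxA ETh // mulmx1.
have y0 : y != 0 by apply: contraNneq z0 => y0; rewrite -yT y0 mul0mx.
exists (2 * P y) => q.
have qT : (q *m Em x) *m Th x = q by rewrite -mulmxA ETh // mulmx1.
have := spray_hess oU Ux FE unitTh dphi dphi' hTh (q *m Em x) y0 (posF y0).
rewrite /= yT qT bracket_coframe denergyN => <-; congr hess.
rewrite addrAC; congr (_ - _).
have -> : \row_i spray F c x y i = 2^-1 *: G y y + P y *: y.
  apply/rowP => i; rewrite [LHS]mxE douglasE // [RHS]mxE.
  by congr (_ + _); rewrite [RHS]mxE // [in RHS]mxE.
rewrite mulmxDl scalerDr -!scalemxAl !scalerA mulfV ?scale1r ?pnatr_eq0 //.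
by rewrite yT.
Qed.

End DouglasInFrame.

(** * What the identity says about phi *)

Section LieBilinear.
Context {R : realType} {n : nat}.
Variable C : 'I_n -> 'I_n -> 'rV[R]_n.
Implicit Types u v w : 'rV[R]_n.

Lemma lieDl u v w : lie_bracket C (u + v) w = lie_bracket C u w + lie_bracket C v w.
Proof.
rewrite /lie_bracket -big_split; apply: eq_bigr => i _; rewrite -big_split.
by apply: eq_bigr => j _; rewrite mxE mulrDl scalerDl.
Qed.
Lemma lieZl a v w : lie_bracket C (a *: v) w = a *: lie_bracket C v w.
Proof.
rewrite /lie_bracket scaler_sumr; apply: eq_bigr => i _; rewrite scaler_sumr.
by apply: eq_bigr => j _; rewrite mxE scalerA mulrA.
Qed.
Hypothesis Canti : forall i j, C i j = - C j i.
Lemma lie_anti u v : lie_bracket C u v = - lie_bracket C v u.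
Proof.
rewrite /lie_bracket exchange_big -sumrN; apply: eq_bigr => i _; rewrite -sumrN.
by apply: eq_bigr => j _; rewrite Canti scalerN mulrC.
Qed.
Lemma lie_self u : lie_bracket C u u = 0.
Proof.
have /eqP := lie_anti u u.
by rewrite -addr_eq0 -mulr2n -scaler_nat scaler_eq0 pnatr_eq0 => /eqP.
Qed.
Lemma lieDr u v w : lie_bracket C w (u + v) = lie_bracket C w u + lie_bracket C w v.
Proof. by rewrite lie_anti lieDl opprD -!(lie_anti w). Qed.
Lemma lieZr a v w : lie_bracket C w (a *: v) = a *: lie_bracket C w v.
Proof. by rewrite lie_anti lieZl -scalerN -lie_anti. Qed.
End LieBilinear.

Section DouglasAlgebra.
Context {R : realType} {n : nat}.
Variables (phi : R -> R) (X : 'rV[R]_n) (C : 'I_n -> 'I_n -> 'rV[R]_n).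
Variable B : 'rV[R]_n -> 'rV[R]_n -> 'rV[R]_n.
Hypothesis Canti : forall i j, C i j = - C j i.
Hypotheses (Bl : forall w, linear (B w)) (Br : forall w, linear (B^~ w)).
Hypothesis HN : forall z : 'rV[R]_n, z != 0 -> exists rho, forall q,
  hess phi X z (B z z + rho *: z) q = - denergy phi X z (lie_bracket C z q).
Local Notation b := (dotnorm X).
Local Notation psi := (psi phi).
Local Notation phi1 := (derive1 phi).
Local Notation phi2 := (derive1 (derive1 phi)).
Hypothesis phi_gt0 : forall s, `|s| < b -> 0 < phi s.
Hypothesis psi_gt0 : forall s, `|s| < b -> 0 < psi s.

Local Notation Delta s := (psi s + (b ^+ 2 - s ^+ 2) * phi2 s).

Lemma BDr w u v : B w (u + v) = B w u + B w v.
Proof. by have := Bl w 1 u v; rewrite !scale1r. Qed.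
Lemma BZr w a v : B w (a *: v) = a *: B w v.
Proof.
have B0 : B w 0 = 0 by apply: (addrI (B w 0)); rewrite -BDr !addr0.
by have := Bl w a v 0; rewrite B0 !addr0.
Qed.
Lemma BDl w u v : B (u + v) w = B u w + B v w.
Proof. by have := Br w 1 u v; rewrite !scale1r. Qed.
Lemma BZl w a v : B (a *: v) w = a *: B v w.
Proof.
have B0 : B 0 w = 0 by apply: (addrI (B 0 w)); rewrite -BDl !addr0.
by have := Br w a v 0; rewrite B0 !addr0.
Qed.

Lemma dot_slope (z : 'rV[R]_n) : z != 0 -> dot X z = dotnorm z * slope X z.
Proof. by move=> /dotnorm_gt0 a0; rewrite /slope mulrC divfK // gt_eqF. Qed.

(** For w orthogonal to z and X the Hessian is a multiple of the scalar product,
    and rho disappears. *)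
Lemma transversal_identity (z w : 'rV[R]_n) : z != 0 -> `|slope X z| < b ->
  dot X w = 0 -> dot z w = 0 ->
  psi (slope X z) * (dot w (B z z) + dot z (lie_bracket C z w))
  = - (dotnorm z * phi1 (slope X z) * dot X (lie_bracket C z w)).
Proof.
move=> z0 zb Xw zw; have [rho /(_ w)] := HN z0.
have p0 := phi_gt0 zb.
rewrite /hess /denergy (dotDl _ _ w) dotZl zw Xw (dotC w) !(mulr0, addr0, mul0r, subr0).
move: (dot X (lie_bracket _ _ _)) (dot z (lie_bracket _ _ _)) (dot (B z z) w) => A1 A2 A3 E.
apply: (mulfI (lt0r_neq0 p0)).
apply/eqP; rewrite -subr_eq0; apply/eqP.
by move/eqP: E; rewrite -subr_eq0 => /eqP <-; ring.
Qed.

(** The vector |z|^2 X - <X, z> z is orthogonal to z, so that rho disappears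
    again.  The identity at q = z, where [z, z] = 0, relates the scalar products of
    B(z,z) + rho z with z and with X, which leaves a single unknown. *)
Lemma radial_identity (z : 'rV[R]_n) : z != 0 -> `|slope X z| < b ->
  (forall u v, dot X (lie_bracket C u v) = 0) ->
  let s := slope X z in
  Delta s * dot (dotnorm z ^+ 2 *: X - dot X z *: z) (B z z)
  = - (dotnorm z ^+ 2 * psi s * dot z (lie_bracket C z X)).
Proof.
move=> z0 zb XC s; have [rho HNz] := HN z0.
have p0 := phi_gt0 zb; have ps0 := psi_gt0 zb; have a0 := dotnorm_gt0 z0.
set p := dotnorm z ^+ 2 *: X - dot X z *: z; set N := B z z + rho *: z.
have Xz := dot_slope z0; rewrite -/s in Xz.
have zp : dot z p = 0.
  by rewrite dotBr !dotZr -sqr_dotnorm (dotC z) Xz; ring.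
have Xp : dot X p = dotnorm z ^+ 2 * (b ^+ 2 - s ^+ 2).
  by rewrite dotBr !dotZr -sqr_dotnorm Xz; ring.
have pN : dot p (B z z) = dot p N.
  by rewrite dotDr dotZr (dotC p z) zp mulr0 addr0.
have pN' : dot p N = dotnorm z ^+ 2 * dot X N - dotnorm z * s * dot z N.
  by rewrite dotBl !dotZl Xz.
have zlie : dot z (lie_bracket C z p) = dotnorm z ^+ 2 * dot z (lie_bracket C z X).
  by rewrite /p lieDr // -scaleNr !lieZr // lie_self // scaler0 addr0 dotZr.
have := HNz p; have := HNz z.
rewrite lie_self // denergy0 oppr0 -/N /hess /denergy zlie XC zp Xp Xz -sqr_dotnorm.
rewrite (dotC N z) (dotC N p) -/s !pN pN' /kcoef /hcoef -/(psi s).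
have psE : psi s = phi s - s * phi1 s by [].
move: (dot X N) (dot z N) (dot z (lie_bracket C z X)) psE a0 p0 ps0 => n2 n1 sg.
rewrite -/s; move: (phi s) (psi s) (phi1 s) (phi2 s) (dotnorm z) (b) => f g f1 f2 a b' gE a0 f0 g0.
have a1 : a != 0 by rewrite gt_eqF.
move=> E1 E2.
(* The identity at q = z is dL_z (N) = 0, by homogeneity of L. *)
have {}E1 : g * n1 = - (a * f1 * n2).
  have E : f * (g * n1 + a * f1 * n2) = 0.
    rewrite -[RHS]E1 gE; field; exact: a1.
  move/eqP: E; rewrite mulf_eq0 gt_eqF //= => /eqP; lra.
have fE : f = g + s * f1 by rewrite gE subrK.
have n1E : n1 = - (a * f1 * n2) / g by rewrite -E1 mulrC mulKf // gt_eqF.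
apply: (mulfI (lt0r_neq0 f0)); apply/eqP; rewrite -subr_eq0; apply/eqP.
move/eqP: E2; rewrite -subr_eq0 => /eqP E3; rewrite -[RHS]E3.
have g1 : g != 0 by rewrite gt_eqF.
rewrite n1E fE; field; by rewrite g1 a1.
Qed.

(** Both curves e = 1 and e = -1 realise every slope |s| < |X| on vectors of
    the same length; the coefficients avoid any division. *)
Lemma plane_curve (v : 'rV[R]_n) (s e : R) : X != 0 -> v != 0 -> dot X v = 0 ->
  `|s| < b -> e ^+ 2 = 1 ->
  let c := Num.sqrt (b ^+ 2 - s ^+ 2) in
  let z := (s * dotnorm v) *: X + (e * (b * c)) *: v in
  [/\ z != 0, dotnorm z = b ^+ 2 * dotnorm v & slope X z = s].
Proof.
move=> X0 v0 Xv sb e2 c z.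
have b0 := dotnorm_gt0 X0; have a0 := dotnorm_gt0 v0.
have s2 : s ^+ 2 <= b ^+ 2.
  by rewrite -(real_normK (num_real s)) ler_sqr ?nnegrE ?normr_ge0 ?(ltW sb) ?(ltW b0).
have c2 : c ^+ 2 = b ^+ 2 - s ^+ 2 by rewrite sqr_sqrtr ?subr_ge0.
have zz : dot z z = (b ^+ 2 * dotnorm v) ^+ 2.
  rewrite /z !dotDl !dotDr !dotZl !dotZr (dotC v X) Xv -!sqr_dotnorm.
  transitivity (s ^+ 2 * dotnorm v ^+ 2 * b ^+ 2 + e ^+ 2 * (b ^+ 2 * c ^+ 2) * dotnorm v ^+ 2); first ring.
  by rewrite e2 c2; ring.
have alz : dotnorm z = b ^+ 2 * dotnorm v.
  by rewrite /dotnorm zz sqrtr_sqr ger0_norm // mulr_ge0 ?sqr_ge0 // ltW.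
have z0 : z != 0 by rewrite -dot_gt0 zz exprn_gt0 // mulr_gt0 // exprn_gt0.
split=> //; rewrite /slope alz dotDr !dotZr Xv -sqr_dotnorm.
by field; rewrite !gt_eqF.
Qed.

(** Subtracting [transversal_identity] on the two curves kills everything even in
    v.  What remains of B and of the bracket is a constant times s, because
    their common factor sqrt (|X|^2 - s^2) cancels. *)
Lemma douglas_nonclosed v w : X != 0 ->
  dot X v = 0 -> dot X w = 0 -> dot v w = 0 -> dot X (lie_bracket C v w) != 0 ->
  exists k, forall s, `|s| < b -> phi1 s = k * s * psi s.
Proof.
move=> X0 Xv Xw vw tau0; set tau := dot X _ in tau0.
have b0 := dotnorm_gt0 X0.
have v0 : v != 0.
  by apply: contraNneq tau0 => v0; rewrite /tau v0 -(scale0r 0) lieZl scale0r dot0r.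
have a0 := dotnorm_gt0 v0.
pose D z z' := dot w (B z z') + dot z (lie_bracket C z' w).
exists (- (D X v + D v X) / (b ^+ 2 * tau)) => s sb.
have c0 : 0 < Num.sqrt (b ^+ 2 - s ^+ 2).
  rewrite sqrtr_gt0 subr_gt0 -(real_normK (num_real s)).
  by rewrite ltr_sqr ?nnegrE ?normr_ge0 // ltW.
have ps0 := psi_gt0 sb.
set c := Num.sqrt _ in c0.
have E e : e ^+ 2 = 1 -> let z := (s * dotnorm v) *: X + (e * (b * c)) *: v in
    psi s * D z z = - (b ^+ 2 * dotnorm v * phi1 s * dot X (lie_bracket C z w)).
  move=> e2 z; have [z0 alz sz] := plane_curve X0 v0 Xv sb e2.
  rewrite -/c -/z in z0 alz sz.
  rewrite -[in phi1 s]sz -alz -[in LHS]sz; apply: transversal_identity; rewrite ?sz //.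
  by rewrite dotDl !dotZl Xw vw !mulr0 addr0.
have {}E e : e ^+ 2 = 1 -> psi s * ((s * dotnorm v) ^+ 2 * D X X + e * (s * dotnorm v * (b * c)) * (D X v + D v X)
    + (b * c) ^+ 2 * D v v) =
    - (b ^+ 2 * dotnorm v * phi1 s * (s * dotnorm v * dot X (lie_bracket C X w) + e * (b * c) * tau)).
  move=> e2; have := E e e2; rewrite /= /D.
  rewrite !(BDl, BDr, BZl, BZr, lieDl, lieZl, dotDl, dotDr, dotZl, dotZr) -/tau => E1.
  rewrite -[RHS]E1; congr (_ * _); ring: e2.
have E1 := E 1 (expr1n _ _); have E2 : _ := E (-1) (etrans (sqrrN 1) (expr1n _ _)).
have key : 2 * (b * c) * dotnorm v * (psi s * s * (D X v + D v X) + b ^+ 2 * phi1 s * tau) = 0.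
  move: E1 E2; move: (D X v + D v X) (D X X) (D v v) => d1 d2 d3.
  move: (dot X (lie_bracket C X w)) (phi1 s) (psi s) => t0 p1 p0 E1 E2.
  apply/eqP; rewrite -subr_eq0; apply/eqP.
  have := congr2 (fun x y => x - y) E1 E2.
  move/eqP; rewrite -subr_eq0 => /eqP E3; rewrite -[RHS]E3; ring.
move/eqP: key; rewrite !mulf_eq0 pnatr_eq0 (gt_eqF b0) (gt_eqF c0) (gt_eqF a0) /= => /eqP key.
apply: (mulfI (mulf_neq0 (lt0r_neq0 (exprn_gt0 2 b0)) tau0)).
apply/eqP; rewrite -subr_eq0; apply/eqP; rewrite -[RHS]key.
by field; rewrite tau0 gt_eqF.
Qed.

(** Adding [radial_identity] on the two curves kills everything odd in v.  The
    bracket term is <v, [v, X]>, up to factors, since <X, [v, X]> = 0, and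
    everything that remains carries the factor |X|^2 - s^2, which cancels. *)
Lemma douglas_closed v : X != 0 -> (forall u u', dot X (lie_bracket C u u') = 0) ->
  dot X v = 0 -> dot v (lie_bracket C v X) != 0 ->
  exists m1 m2, forall s, `|s| < b ->
    psi s = (s ^+ 2 * m1 + (b ^+ 2 - s ^+ 2) * m2) * Delta s.
Proof.
move=> X0 XC Xv; set tau := dot v _ => tau0.
have b0 := dotnorm_gt0 X0.
have v0 : v != 0.
  by apply: contraNneq tau0 => v0; rewrite /tau v0 dot0l.
have a0 := dotnorm_gt0 v0.
pose n1 := dotnorm v ^+ 2 * dot X (B X X) - b ^+ 2 * (dot v (B X v) + dot v (B v X)).
pose n2 := b ^+ 2 * dot X (B v v).
exists (- n1 / (b ^+ 4 * tau)), (- n2 / (b ^+ 4 * tau)) => s sb.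
have c2_gt0 : 0 < b ^+ 2 - s ^+ 2.
  rewrite subr_gt0 -(real_normK (num_real s)).
  by rewrite ltr_sqr ?nnegrE ?normr_ge0 // ltW.
have c0 : 0 < Num.sqrt (b ^+ 2 - s ^+ 2) by rewrite sqrtr_gt0.
have c2 : Num.sqrt (b ^+ 2 - s ^+ 2) ^+ 2 = b ^+ 2 - s ^+ 2.
  by rewrite sqr_sqrtr // ltW.
set c := Num.sqrt _ in c0 c2.
pose p e := (b ^+ 4 * dotnorm v ^+ 2 - b ^+ 2 * dotnorm v * s * (s * dotnorm v)) *: X
  - (b ^+ 2 * dotnorm v * s * (e * (b * c))) *: v.
have E e : e ^+ 2 = 1 -> let z := (s * dotnorm v) *: X + (e * (b * c)) *: v in
    Delta s * dot (p e) (B z z) = - (b ^+ 4 * dotnorm v ^+ 2 * psi s * (b ^+ 2 * c ^+ 2 * tau)).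
  move=> e2 z; have [z0 alz sz] := plane_curve X0 v0 Xv sb e2.
  rewrite -/c -/z in z0 alz sz.
  have sb' : `|slope X z| < b by rewrite sz.
  have := radial_identity z0 sb' XC; rewrite /= sz (dot_slope z0) alz sz.
  have -> : dot z (lie_bracket C z X) = b ^+ 2 * c ^+ 2 * tau.
    rewrite /z lieDl !lieZl lie_self // scaler0 add0r dotDl !dotZl !dotZr XC -/tau.
    by ring: e2.
  have -> : (b ^+ 2 * dotnorm v) ^+ 2 *: X - (b ^+ 2 * dotnorm v * s) *: z = p e.
    rewrite /z /p scalerDr !scalerA opprD addrA -scalerBl; congr (_ *: _ - _).
    by ring.
  by move=> ->; ring.
have {}E e : e ^+ 2 = 1 -> Delta s * (
    (b ^+ 2 * dotnorm v ^+ 2 * c ^+ 2) * ((s * dotnorm v) ^+ 2 * dot X (B X X)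
      + e * (s * dotnorm v * (b * c)) * (dot X (B X v) + dot X (B v X))
      + (b * c) ^+ 2 * dot X (B v v))
    - b ^+ 2 * dotnorm v * s * (e * (b * c)) * ((s * dotnorm v) ^+ 2 * dot v (B X X)
      + e * (s * dotnorm v * (b * c)) * (dot v (B X v) + dot v (B v X))
      + (b * c) ^+ 2 * dot v (B v v)))
    = - (b ^+ 4 * dotnorm v ^+ 2 * psi s * (b ^+ 2 * c ^+ 2 * tau)).
  move=> e2; have := E e e2; rewrite /= /p dotBl !dotZl.
  rewrite !(BDl, BDr, BZl, BZr, dotDr, dotZr) => E1.
  by rewrite -[RHS]E1 c2; congr (_ * _); ring: e2.
have E1 := E 1 (expr1n _ _); have E2 := E (-1) (etrans (sqrrN 1) (expr1n _ _)).
have key : 2 * dotnorm v ^+ 2 * b ^+ 2 * c ^+ 2 * (Delta s * (s ^+ 2 * n1 + c ^+ 2 * n2)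
   + b ^+ 4 * psi s * tau) = 0.
  move: E1 E2; rewrite /n1 /n2.
  move: (dot X (B X X)) (dot X (B X v)) (dot X (B v X)) (dot X (B v v)) => d1 d2 d3 d4.
  move: (dot v (B X X)) (dot v (B X v)) (dot v (B v X)) (dot v (B v v)) => d5 d6 d7 d8.
  move: (Delta s) (psi s) => De p0 E1 E2.
  have := congr2 (fun x y => x + y) E1 E2.
  move/eqP; rewrite -subr_eq0 => /eqP E3; rewrite -[RHS]E3; ring.
have nz : 2 * dotnorm v ^+ 2 * b ^+ 2 * c ^+ 2 != 0.
  by rewrite gt_eqF // !mulr_gt0 ?exprn_gt0.
move/eqP: key; rewrite mulf_eq0 (negPf nz) /= => /eqP key.
apply: (mulfI (mulf_neq0 (lt0r_neq0 (exprn_gt0 4 b0)) tau0)).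
apply/eqP; rewrite -subr_eq0; apply/eqP; rewrite -[RHS]key c2.
by field; rewrite tau0 gt_eqF.
Qed.

End DouglasAlgebra.

(** * Solving the equation for phi *)

Section OpenIntervals.
Context {R : realType}.
Implicit Types (f h : R -> R) (b s : R).

Lemma eq0_at_right_end h b : 0 < b -> {for b, continuous h} ->
  (forall s, `|s| < b -> h s = 0) -> h b = 0.
Proof.
move=> b0 ch h0.
have c1 : h s @[s --> b^'-] --> h b by apply: cvg_at_left_filter; exact: ch.
have c2 : h s @[s --> b^'-] --> (0 : R).
  apply: (cvg_near_cst 0); near=> s; apply: h0; rewrite ltr_norml.
  apply/andP; split; near: s; first by apply: nbhs_left_gt; lra.
  exact: nbhs_left_lt.
exact: cvg_unique c1 c2.
Unshelve. all: by end_near. Qed.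

Lemma eq0_closed_itv h b : 0 < b ->
  (forall s, `|s| <= b -> {for s, continuous h}) ->
  (forall s, `|s| < b -> h s = 0) -> forall s, `|s| <= b -> h s = 0.
Proof.
move=> b0 ch h0 s; rewrite le_eqVlt => /orP[/eqP sb|]; last exact: h0.
have bb : `|b| <= b by rewrite ger0_norm // ltW.
have [s0|s0] := leP 0 s.
  rewrite ger0_norm // in sb; rewrite sb; apply: eq0_at_right_end => //; exact: ch.
rewrite ltr0_norm // in sb; rewrite -(opprK s) sb.
apply: (@eq0_at_right_end (h \o -%R)) => //; last by move=> t tb; apply: h0; rewrite normrN.
apply: continuous_comp; first exact: opp_continuous.
by apply: ch; rewrite normrN.
Qed.

Lemma is_derive0_cst_open f b : (forall s, `|s| < b -> is_derive s 1 f 0) ->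
  forall s, `|s| < b -> f s = f 0.
Proof.
move=> df s sb.
have sub x y : `|x| < b -> `|y| < b -> x <= y -> f x = f y.
  move=> xb yb xy.
  have inb t : t \in `[x, y] -> `|t| < b.
    rewrite in_itv /= => /andP[xt ty]; move: xb yb; rewrite !ltr_norml.
    by move=> /andP[xb1 xb2] /andP[yb1 yb2]; apply/andP; split; lra.
  have [||t _] := @MVT_segment _ f (fun=> 0) x y xy.
  - by move=> t /subset_itv_oo_cc /inb; exact: df.
  - by apply: derivable_within_continuous => t /inb /df [].
  - by rewrite mul0r => /eqP; rewrite subr_eq0 => /eqP.
have b0 : `|0 : R| < b by rewrite normr0 (le_lt_trans _ sb).
by have [s0|s0] := leP 0 s; [apply/esym|]; apply: sub => //; exact: ltW.
Qed.

End OpenIntervals.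

Section PhiEquation.
Context {R : realType}.
Variables (phi : R -> R) (b0 b : R).
Hypotheses (b_gt0 : 0 < b) (bb0 : b < b0).
Local Notation psi := (psi phi).
Local Notation phi1 := (derive1 phi).
Local Notation phi2 := (derive1 (derive1 phi)).
Hypothesis dphi : forall s : R, `|s| < b0 -> derivable phi s 1.
Hypothesis dphi1 : forall s : R, `|s| < b0 -> derivable phi1 s 1.
Hypothesis cphi2 : forall s : R, `|s| < b0 -> {for s, continuous phi2}.
Hypothesis psi_gt0 : forall s : R, `|s| < b0 -> 0 < psi s.

Let ltb (s : R) : `|s| < b -> `|s| < b0. Proof. by move=> /lt_trans; exact. Qed.
Let leb (s : R) : `|s| <= b -> `|s| < b0. Proof. by move=> /le_lt_trans; exact. Qed.

Let hphi (s : R) : `|s| < b0 -> is_derive s 1 phi (phi1 s).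
Proof. by move=> /dphi /derivable_is_derive1. Qed.
Let hphi1 (s : R) : `|s| < b0 -> is_derive s 1 phi1 (phi2 s).
Proof. by move=> /dphi1 /derivable_is_derive1. Qed.

Lemma is_derive_psi (s : R) : `|s| < b0 -> is_derive s 1 psi (- (s * phi2 s)).
Proof.
move=> sb; apply: is_derive_eq (is_deriveBf (hphi sb)
  (is_deriveMf (is_derive_id _ _) (hphi1 sb))) _.
by rewrite mul1r opprD addrA subrr add0r.
Qed.

Let continuous_derive (f : R -> R) (s d : R) : is_derive s 1 f d -> {for s, continuous (f : R -> R)}.
Proof. by case=> /derivable1_diffP /differentiable_continuous. Qed.
Let cphi (s : R) : `|s| < b0 -> {for s, continuous phi}.
Proof. by move=> /hphi /continuous_derive. Qed.
Let cpsi (s : R) : `|s| < b0 -> {for s, continuous psi}.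
Proof. by move=> /is_derive_psi /continuous_derive. Qed.

(** Differentiate the hypothesis, using psi' = - s phi''. *)
Lemma phi_equation_nonclosed k :
  (forall s : R, `|s| < b -> phi1 s = k * s * psi s) ->
  forall s : R, `|s| < b -> (1 + k * s ^+ 2) * phi2 s = k * psi s.
Proof.
move=> E s sb.
have h1 : is_derive s 1 phi1 (k * psi s + k * s * (- (s * phi2 s))).
  have h : is_derive s 1 (fun t => k * t * psi t) (k * psi s + k * s * (- (s * phi2 s))).
    apply: is_derive_eq (is_deriveMf (is_deriveMf (is_derive_cstf k _ _)
       (is_derive_id _ _)) (is_derive_psi (ltb sb))) _.
    by rewrite mul0r add0r mulr1.
  apply: near_eq_is_derive h; near=> t; apply/esym/E.
  near: t; apply: (cvgr_lt `|s|); [exact: norm_continuous|exact: sb].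
have [_ e1] := h1; have [_ e2] := hphi1 (ltb sb).
by move: e2; rewrite e1 => e2; rewrite mulrDl -{1}e2; ring.
Unshelve. all: by end_near. Qed.

(** At s = b the hypothesis reads psi b = b^2 m1 psi b, hence b^2 m1 = 1; then
    b^2 - s^2 factors out of it and the equation for phi'' is left.  The
    coefficient m below is not zero, as phi 0 would vanish otherwise. *)
Lemma phi_equation_closed m1 m2 :
  (forall s : R, `|s| < b -> psi s = (s ^+ 2 * m1 + (b ^+ 2 - s ^+ 2) * m2)
      * (psi s + (b ^+ 2 - s ^+ 2) * phi2 s)) ->
  exists k, forall s : R, `|s| < b -> (1 + k * s ^+ 2) * phi2 s = k * psi s.
Proof.
move=> E; have bb : `|b| < b0 by rewrite ger0_norm // ltW.
have m1E : b ^+ 2 * m1 = 1.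
  pose h (s : R) := (s ^+ 2 * m1 + (b ^+ 2 - s ^+ 2) * m2)
      * (psi s + (b ^+ 2 - s ^+ 2) * phi2 s) - psi s.
  have hb : h b = 0.
    apply: eq0_at_right_end => //; last by move=> s sb; rewrite /h -E // subrr.
    have cs : {for b, continuous (fun s : R => s ^+ 2)} by exact: exprn_continuous.
    have cst (r : R) : {for b, continuous (fun=> r : R)} by exact: cst_continuous.
    apply: continuousB; last exact: cpsi.
    apply: continuousM.
      apply: continuousD; apply: continuousM => //.
      exact: (continuousB (cst _) cs).
    apply: continuousD; first exact: cpsi.
    by apply: continuousM; [exact: (continuousB (cst _) cs)|exact: cphi2].
  move: hb; rewrite /h subrr !mul0r !addr0 => /eqP.
  rewrite subr_eq0 -{2}[psi b]mul1r => /eqP; apply: mulIf.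
  by rewrite gt_eqF // psi_gt0.
pose m := b ^+ 2 * m2.
have b20 : b ^+ 2 != 0 by rewrite gt_eqF // exprn_gt0.
have Em (s : R) : `|s| < b -> phi2 s * (s ^+ 2 + m * (b ^+ 2 - s ^+ 2)) = (1 - m) * psi s.
  move=> sb.
  have c2 : b ^+ 2 - s ^+ 2 != 0.
    rewrite gt_eqF // subr_gt0 -(real_normK (num_real s)).
    by rewrite ltr_sqr ?nnegrE ?normr_ge0 // ltW.
  have := E s sb; move: (psi s) (phi2 s) => p p2 E'.
  apply: (mulfI c2); apply/eqP; rewrite -subr_eq0; apply/eqP.
  have : b ^+ 2 * ((s ^+ 2 * m1 + (b ^+ 2 - s ^+ 2) * m2)
     * (p + (b ^+ 2 - s ^+ 2) * p2) - p) = 0 by rewrite -E' subrr mulr0.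
  move=> E0; rewrite -[RHS]E0 /m.
  have -> : m1 = (b ^+ 2)^-1 by apply: (mulfI b20); rewrite m1E divff.
  by field; rewrite gt_eqF.
have m0 : m != 0.
  apply/negP => /eqP m0; have := Em 0; rewrite normr0 m0 => /(_ b_gt0).
  rewrite expr0n /= mul0r addr0 mulr0 subr0 mul1r => /esym /eqP.
  by rewrite gt_eqF // psi_gt0 // normr0 (lt_trans b_gt0).
exists ((1 - m) / (m * b ^+ 2)) => s sb.
have mb : m * b ^+ 2 != 0 by rewrite mulf_neq0.
apply: (mulfI mb); rewrite mulrA.
have -> : m * b ^+ 2 * (1 + (1 - m) / (m * b ^+ 2) * s ^+ 2)
  = s ^+ 2 + m * (b ^+ 2 - s ^+ 2) by field; rewrite m0 gt_eqF.
by rewrite mulrC Em //; field; rewrite m0 gt_eqF.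
Qed.

(** If 1 + k s^2 vanished at t, the equation would give k psi t = 0.  As for the
    solution, with r = sqrt (1 + k s^2), the derivatives of psi r,
    of phi' - phi 0 r' and of phi - phi 0 r - phi' 0 s vanish in turn. *)
Lemma phi_solution k :
  (forall s : R, `|s| < b -> (1 + k * s ^+ 2) * phi2 s = k * psi s) ->
  forall s : R, `|s| <= b -> 0 < 1 + k * s ^+ 2 /\
    phi s = phi 0 * Num.sqrt (1 + k * s ^+ 2) + phi1 0 * s.
Proof.
move=> E.
pose w (s : R) := 1 + k * s ^+ 2.
have hw (s : R) : is_derive s 1 w (2 * k * s).
  have h2 : is_derive s 1 (fun t : R => t * t) (1 * s + s * 1).
    exact: is_deriveMf (is_derive_id _ _) (is_derive_id _ _).
  have h := is_deriveDf (is_derive_cstf (1 : R) s 1) (is_deriveMf (is_derive_cstf k s 1) h2).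
  by apply: is_derive_eq h _; ring.
have Ec (s : R) : `|s| <= b -> w s * phi2 s = k * psi s.
  move=> sb; apply/eqP; rewrite -subr_eq0; apply/eqP; move: s sb.
  apply: eq0_closed_itv => // [s sb|s sb]; last by rewrite -E // subrr.
  apply: continuousB; apply: continuousM.
  - exact: continuous_derive (hw s).
  - exact/cphi2/leb.
  - exact: cst_continuous.
  - exact/cpsi/leb.
have w0 (s : R) : `|s| <= b -> 0 < w s.
  move=> sb; rewrite ltNge; apply/negP => ws.
  have k0 : k < 0.
    rewrite ltNge; apply/negP => k0; move: ws; rewrite /w.
    by have := mulr_ge0 k0 (sqr_ge0 s); lra.
  (* The zero of w, which |s| bounds as w s <= 0. *)
  pose t := Num.sqrt (- k^-1).
  have kV : 0 < - k^-1 by rewrite oppr_gt0 invr_lt0.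
  have t2 : t ^+ 2 = - k^-1 by rewrite sqr_sqrtr // ltW.
  have tb : `|t| <= b.
    rewrite ger0_norm ?sqrtr_ge0 //; apply: le_trans sb.
    rewrite -ler_sqr ?nnegrE ?sqrtr_ge0 ?normr_ge0 // t2 real_normK ?num_real //.
    rewrite -(ler_nM2l k0) mulrN mulfV ?lt_eqF //; move: ws; rewrite /w; lra.
  have := Ec t tb; rewrite /w t2 mulrN mulfV ?lt_eqF // subrr mul0r => /esym/eqP.
  by rewrite mulf_eq0 lt_eqF //= gt_eqF // psi_gt0 // leb.
have b_norm0 : `|0 : R| < b by rewrite normr0.
pose r (s : R) := Num.sqrt (w s).
have r2 (s : R) : `|s| < b -> r s ^+ 2 = w s.
  by move=> /ltW /w0 ?; rewrite sqr_sqrtr // ltW.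
have r_gt0 (s : R) : `|s| < b -> 0 < r s by move=> /ltW /w0; rewrite sqrtr_gt0.
have hr (s : R) : `|s| < b -> is_derive s 1 r (k * s / r s).
  move=> sb; apply: is_derive_eq (is_derive_comp1
    (is_derive1_sqrt (w0 _ (ltW sb))) (hw s)) _.
  by rewrite -/(r s); field; rewrite gt_eqF // r_gt0.
have r0 : r 0 = 1 by rewrite /r /w expr0n /= mulr0 addr0 sqrtr1.
have psi_r (s : R) : `|s| < b -> psi s * r s = phi 0.
  move=> sb; have -> : phi 0 = psi 0 * r 0 by rewrite r0 mulr1 /psi mul0r subr0.
  apply: (is_derive0_cst_open (f := fun s : R => psi s * r s)) (sb) => t tb.
  apply: is_derive_eq (is_deriveMf (is_derive_psi (ltb tb)) (hr t tb)) _.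
  have := r_gt0 t tb; have := r2 t tb; have := Ec t (ltW tb).
  move=> E1 E2 /lt0r_neq0 rn0; apply: (mulfI rn0).
  have -> : r t * (- (t * phi2 t) * r t + psi t * (k * t / r t)) =
    t * (k * psi t - r t ^+ 2 * phi2 t) by field.
  by rewrite E2 E1 subrr !mulr0.
have phi1E (s : R) : `|s| < b -> phi1 s = phi 0 * (k * s / r s) + phi1 0.
  move=> sb; apply/eqP; rewrite addrC -subr_eq; apply/eqP.
  have -> : phi1 0 = phi1 0 - phi 0 * (k * 0 / r 0) by rewrite mulr0 mul0r mulr0 subr0.
  apply: (is_derive0_cst_open (f := fun s : R => phi1 s - phi 0 * (k * s / r s))) (sb).
  move=> t tb; have rn0 := lt0r_neq0 (r_gt0 t tb).
  apply: is_derive_eq (is_deriveBf (hphi1 (ltb tb)) (is_deriveMf (is_derive_cstf (phi 0) t 1)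
    (is_deriveMf (is_deriveMf (is_derive_cstf k t 1) (is_derive_id t 1))
       (is_deriveVf (hr t tb) rn0)))) _.
  have := r2 t tb; have := Ec t (ltW tb); have := psi_r t tb.
  move=> E1 E2 E3; apply: (mulfI (expf_neq0 3 rn0)).
  rewrite mulr0 -E1.
  transitivity (r t * (r t ^+ 2 * phi2 t - k * psi t * (r t ^+ 2 - k * t ^+ 2))); first by field.
  by rewrite E3 E2 /w; ring.
have phiE (s : R) : `|s| < b -> phi s = phi 0 * r s + phi1 0 * s.
  move=> sb; apply/eqP; rewrite -subr_eq0; apply/eqP.
  transitivity (phi 0 - (phi 0 * r 0 + phi1 0 * 0)); last by rewrite r0; ring.
  apply: (is_derive0_cst_open (f := fun s => phi s - (phi 0 * r s + phi1 0 * s)) _ sb).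
  move=> t tb.
  apply: is_derive_eq (is_deriveBf (hphi (ltb tb)) (is_deriveDf
    (is_deriveMf (is_derive_cstf (phi 0) t 1) (hr t tb))
    (is_deriveMf (is_derive_cstf (phi1 0) t 1) (is_derive_id t 1)))) _.
  by rewrite phi1E //; ring.
move=> s sb; split; first exact: w0.
apply/eqP; rewrite -subr_eq0; apply/eqP; move: s sb.
apply: eq0_closed_itv => // [s sb|s sb]; last by rewrite -phiE // subrr.
apply: continuousB; first exact/cphi/leb.
apply: continuousD; apply: continuousM; do ?exact: cst_continuous.
  apply: (continuous_comp (continuous_derive (hw s))); exact: sqrt_continuous.
exact: cvg_id.
Qed.

End PhiEquation.

(** * The Lie algebra l_{5,5} *)

Section L55.
Context {R : realType}.
Variables (a b c d e : R).
Hypotheses (a0 : 0 < a) (d0 : 0 < d) (e0 : 0 < e).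
Implicit Types (X v w z q : 'rV[R]_5).

(** The coefficients are given for i < j only, and they vanish for i >= j; taking
    the difference makes the constants antisymmetric. *)
Definition l55_structure (i j : 'I_5) : 'rV[R]_5 :=
  \row_k ((l55_coef a b c d e i.+1 j.+1)`_k - (l55_coef a b c d e j.+1 i.+1)`_k).

Lemma l55_structure_anti i j : l55_structure i j = - l55_structure j i.
Proof. by apply/rowP => k; rewrite !mxE opprB. Qed.

(** Coordinates are counted from 0: coord v 3 and coord v 4 are the components on
    E_4 and E_5. *)
Definition coord v k := v 0 (inord k : 'I_5).
Definition vec5 (s : seq R) : 'rV[R]_5 := \row_k s`_k.

Lemma coord_vec5 s k : (k < 5)%N -> coord (vec5 s) k = s`_k.
Proof. by move=> k5; rewrite /coord mxE inordK. Qed.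

Lemma sum_ord5 (f : 'I_5 -> R) :
  \sum_i f i = f (inord 0) + f (inord 1) + f (inord 2) + f (inord 3) + f (inord 4).
Proof.
rewrite !big_ord_recl big_ord0 addr0 !addrA.
by do !congr (_ + _); congr f; apply: val_inj; rewrite /= inordK.
Qed.

Lemma dot5 v w : dot v w = coord v 0 * coord w 0 + coord v 1 * coord w 1
  + coord v 2 * coord w 2 + coord v 3 * coord w 3 + coord v 4 * coord w 4.
Proof. by rewrite dotE sum_ord5. Qed.

Lemma dot_lie v z q : dot v (lie_bracket l55_structure z q) =
  (coord v 3 * a + coord v 4 * b) * (coord z 0 * coord q 1 - coord z 1 * coord q 0)
  + coord v 4 * (c * (coord z 0 * coord q 2 - coord z 2 * coord q 0)
    + d * (coord z 0 * coord q 3 - coord z 3 * coord q 0)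
    + e * (coord z 1 * coord q 2 - coord z 2 * coord q 1)).
Proof.
have E k : (lie_bracket l55_structure z q) 0 k = \sum_(i < 5) \sum_(j < 5)
   coord z i * coord q j * ((l55_coef a b c d e i.+1 j.+1)`_k - (l55_coef a b c d e j.+1 i.+1)`_k).
  rewrite summxE; apply: eq_bigr => i _; rewrite summxE; apply: eq_bigr => j _.
  by rewrite !mxE /coord !inord_val.
rewrite dotE sum_ord5 !E !sum_ord5 /= !inordK //= /coord; ring.
Qed.

(** The 2-form <X, [., .]> is not zero on the orthogonal of X.  If coord X 4 <> 0
    its value on the projections of E_1 and E_4 along the central E_5 is
    d coord X 4; otherwise E_4 lies in its radical, and the value on the
    projections of E_1 and E_2 along E_4 is a coord X 3.
    Orthogonalising w against v does not change the value. *)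
Lemma nonclosed_pair X : (coord X 3 != 0) || (coord X 4 != 0) ->
  exists v w, [/\ dot X v = 0, dot X w = 0, dot v w = 0 & dot X (lie_bracket l55_structure v w) != 0].
Proof.
move=> X34.
suff [v [w [Xv Xw vw]]] : exists v w,
    [/\ dot X v = 0, dot X w = 0 & dot X (lie_bracket l55_structure v w) != 0].
  have v0 : dot v v != 0.
    rewrite dot_eq0; apply: contraNneq vw => ->.
    by rewrite -(scale0r 0) lieZl scale0r dot0r.
  exists v, (w - (dot v w / dot v v) *: v); split => //.
  - by rewrite dotBr dotZr Xw Xv mulr0 subr0.
  - by rewrite dotBr dotZr divfK // subrr.
  rewrite -scaleNr lieDr ?lieZr; try exact: l55_structure_anti.
  by rewrite lie_self ?scaler0 ?addr0 //; exact: l55_structure_anti.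
have [X4|X4] := eqVneq (coord X 4) 0.
  rewrite X4 eqxx orbF in X34.
  exists (vec5 [:: 1; 0; 0; - coord X 0 / coord X 3; 0]),
    (vec5 [:: 0; 1; 0; - coord X 1 / coord X 3; 0]).
  split; rewrite ?dot_lie ?dot5 !coord_vec5 //= ?X4; try by field.
  rewrite (_ : _ + _ = coord X 3 * a); last by ring.
  by rewrite mulf_neq0 // gt_eqF.
exists (vec5 [:: 1; 0; 0; 0; - coord X 0 / coord X 4]),
    (vec5 [:: 0; 0; 0; 1; - coord X 3 / coord X 4]).
split; rewrite ?dot_lie ?dot5 !coord_vec5 //=; try by field.
rewrite (_ : _ + _ = coord X 4 * d); last by ring.
by rewrite mulf_neq0 // gt_eqF.
Qed.

(** The vector v is a sum of two basis vectors, chosen according to the first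
    non-zero component of X; the value is then - d X_1, a X_2 or e X_3. *)
Lemma closed_radial X : X != 0 -> coord X 3 = 0 -> coord X 4 = 0 ->
  exists2 v, dot X v = 0 & dot v (lie_bracket l55_structure v X) != 0.
Proof.
move=> X0 X3 X4.
have [x0|x0] := eqVneq (coord X 0) 0; last first.
  exists (vec5 [:: 0; 0; 0; 1; 1]); rewrite ?dot_lie ?dot5 !coord_vec5 //= ?X3 ?X4; first by ring.
  rewrite (_ : _ + _ = - d * coord X 0); last by ring.
  by rewrite mulf_neq0 // oppr_eq0 gt_eqF.
have [x1|x1] := eqVneq (coord X 1) 0; last first.
  exists (vec5 [:: 1; 0; 0; 1; 0]); rewrite ?dot_lie ?dot5 !coord_vec5 //= ?X3 ?X4 ?x0; first by ring.
  rewrite (_ : _ + _ = a * coord X 1); last by ring.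
  by rewrite mulf_neq0 // gt_eqF.
have x2 : coord X 2 != 0.
  by move: X0; rewrite -dot_eq0 dot5 X3 X4 x0 x1 !mulr0 !addr0 !add0r mulf_eq0 orbb.
exists (vec5 [:: 0; 1; 0; 0; 1]); rewrite ?dot_lie ?dot5 !coord_vec5 //= ?X3 ?X4 ?x0 ?x1; first by ring.
rewrite (_ : _ + _ = e * coord X 2); last by ring.
by rewrite mulf_neq0 // gt_eqF.
Qed.

Section Phi.
Variables (phi : R -> R) (b0 : R) (X : 'rV[R]_5).
Hypothesis Xb0 : dotnorm X < b0.
Hypothesis dphi : forall s : R, `|s| < b0 -> derivable phi s 1.
Hypothesis dphi1 : forall s : R, `|s| < b0 -> derivable (derive1 phi) s 1.
Hypothesis cphi2 : forall s : R, `|s| < b0 -> {for s, continuous (derive1 (derive1 phi))}.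
Hypothesis phi_gt0 : forall s : R, `|s| < b0 -> 0 < phi s.
Hypothesis psi_gt0 : forall s : R, `|s| < b0 -> 0 < psi phi s.
Variable B : 'rV[R]_5 -> 'rV[R]_5 -> 'rV[R]_5.
Hypotheses (Bl : forall w, linear (B w)) (Br : forall w, linear (B^~ w)).
Hypothesis HN : forall z : 'rV[R]_5, z != 0 -> exists rho, forall q,
  hess phi X z (B z z + rho *: z) q = - denergy phi X z (lie_bracket l55_structure z q).

(** For X = 0 only s = 0 matters, and the formula is trivial. *)
Theorem l55_phi : exists k m, forall s : R, `|s| <= dotnorm X -> 0 < 1 + k * s ^+ 2 /\
    phi s = phi 0 * Num.sqrt (1 + k * s ^+ 2) + m * s.
Proof.
have [X0|X0] := eqVneq X 0.
  exists 0, 0 => s; rewrite X0 /dotnorm dot0r sqrtr0 normr_le0 => /eqP ->.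
  by rewrite !mul0r !addr0 sqrtr1 mulr1.
have bX := dotnorm_gt0 X0.
have lt0 (s : R) : `|s| < dotnorm X -> `|s| < b0 by move=> /lt_trans; exact.
have fg s sb := phi_gt0 (lt0 s sb); have pg s sb := psi_gt0 (lt0 s sb).
suff [k Ek] : exists k, forall s : R, `|s| < dotnorm X ->
    (1 + k * s ^+ 2) * derive1 (derive1 phi) s = k * psi phi s.
  exists k, (derive1 phi 0).
  exact: (phi_solution bX Xb0 dphi dphi1 cphi2 psi_gt0 Ek).
have [X34|] := boolP ((coord X 3 != 0) || (coord X 4 != 0)).
  have [v [w [Xv Xw vw tau0]]] := nonclosed_pair X34.
  have [k Ek] := douglas_nonclosed Bl Br HN fg pg X0 Xv Xw vw tau0.
  by exists k; exact: (phi_equation_nonclosed Xb0 dphi dphi1 Ek).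
rewrite negb_or !negbK => /andP[/eqP X3 /eqP X4].
have [v Xv tau0] := closed_radial X0 X3 X4.
have XC u u' : dot X (lie_bracket l55_structure u u') = 0 by rewrite dot_lie X3 X4; ring.
have [m1 [m2 E]] := douglas_closed l55_structure_anti Bl Br HN fg pg X0 XC Xv tau0.
exact: (phi_equation_closed bX Xb0 dphi dphi1 cphi2 psi_gt0 E).
Qed.

End Phi.
End L55.

(** * Products of functions of class C^k *)

Section SmoothClosure.
Context {R : realType} {V : normedModType R}.
Variables (U : set V) (oU : open U).

Let nearU x : U x -> \forall y \near x, U y.
Proof. by move=> Ux; exact: open_nbhs_nbhs. Qed.

Lemma Ck_on_ext (W : normedModType R) k (f g : V -> W) :
  (forall x, U x -> f x = g x) -> Ck_on k U f -> Ck_on k U g.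
Proof.
elim: k f g => [|k IH] f g fg [cf hf].
all: have cg x : U x -> {for x, continuous g}.
1,3: move=> Ux; have E : {near x, f =1 g} by near=> y; apply: fg; near: y; exact: nearU.
1,2: by have := cvg_trans (near_eq_cvg E) (cf x Ux); rewrite /= (fg x Ux); exact.
  by split.
split=> // v; have [dv hv] := hf v; split=> [x Ux|].
  apply: near_eq_derivable (dv x Ux); near=> y; apply: fg; near: y; exact: nearU.
apply: IH hv => x Ux; apply: near_eq_derive; near=> y; apply: fg; near: y; exact: nearU.
Unshelve. all: by end_near. Qed.

(** Needed in the Leibniz rule, where a function of class C^(k+1) multiplies a
    derivative of class C^k. *)
Lemma Ck_onW (W : normedModType R) k (f : V -> W) : Ck_on k.+1 U f -> Ck_on k U f.
Proof.
elim: k f => [|k IH] f [cf hf]; first by split.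
by split=> // v; have [dv hv] := hf v; split=> //; exact: IH.
Qed.

Lemma Ck_on_cst (W : normedModType R) k (w : W) : Ck_on k U (fun=> w).
Proof.
elim: k w => [|k IH] w; first by split=> // x _; exact: cst_continuous.
split=> [x _|v]; first exact: cst_continuous.
split=> [x _|]; first exact: derivable_cst.
by apply: (Ck_on_ext _ (IH 0)) => x _; have [_ ->] := is_derive_cstf w x v.
Qed.

Lemma Ck_onD k (f g : V -> R) : Ck_on k U f -> Ck_on k U g ->
  Ck_on k U (fun x => f x + g x).
Proof.
elim: k f g => [|k IH] f g [cf hf] [cg hg].
  by split=> // x Ux; apply: continuousD; [exact: cf|exact: cg].
split=> [x Ux|v]; first by apply: continuousD; [exact: cf|exact: cg].
have [df Df] := hf v; have [dg Dg] := hg v.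
have D x : U x -> is_derive x v (fun y => f y + g y) ('D_v f x + 'D_v g x).
  by move=> Ux; apply: is_deriveDf; apply: derivableP; [exact: df|exact: dg].
split=> [x /D []//|]; apply: Ck_on_ext (IH _ _ Df Dg) => x Ux.
by have [_ ->] := D x Ux.
Qed.

Lemma Ck_onM k (f g : V -> R) : Ck_on k U f -> Ck_on k U g ->
  Ck_on k U (fun x => f x * g x).
Proof.
elim: k f g => [|k IH] f g Cf Cg; have [cf hf] := Cf; have [cg hg] := Cg.
  by split=> // x Ux; apply: continuousM; [exact: cf|exact: cg].
split=> [x Ux|v]; first by apply: continuousM; [exact: cf|exact: cg].
have [df Df] := hf v; have [dg Dg] := hg v.
have D x : U x -> is_derive x v (fun y => f y * g y) ('D_v f x * g x + f x * 'D_v g x).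
  by move=> Ux; apply: is_deriveMf; apply: derivableP; [exact: df|exact: dg].
split=> [x /D []//|].
have C := Ck_onD (IH _ _ Df (Ck_onW Cg)) (IH _ _ (Ck_onW Cf) Dg).
by apply: Ck_on_ext C => x Ux; have [_ ->] := D x Ux.
Qed.

Lemma continuous_mxP m n (M : V -> 'M[R]_(m, n)) x :
  (forall i j, {for x, continuous (fun y => M y i j)}) -> {for x, continuous M}.
Proof.
move=> cM; apply/cvgrPdist_le => /= r r0; near=> y.
rewrite /Num.Def.normr /= mx_normrE (bigmax_le _ (ltW r0)) //= => i _.
rewrite !mxE /=.
move: i; near: y; apply: filter_forall => /= i.
exact: ((cvgrPdist_le _ _).1 (cM i.1 i.2)).
Unshelve. all: by end_near. Qed.

Lemma Ck_on_mxP m n k (M : V -> 'M[R]_(m, n)) :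
  Ck_on k U M <-> forall i j, Ck_on k U (fun x => M x i j).
Proof.
have cc N i j x : {for x, continuous (N : V -> 'M[R]_(m, n))} ->
    {for x, continuous (fun y => N y i j)}.
  move=> cN; apply: (@continuous_comp _ _ _ N (fun A => A i j)); first exact: cN.
  exact: coord_continuous.
elim: k M => [|k IH] M; split.
- by move=> [cM _] i j; split=> // x Ux; apply: cc; exact: cM.
- move=> h; split=> // x Ux; apply: continuous_mxP => i j.
  by have [c _] := h i j; exact: c.
- move=> [cM hM] i j; split=> [x Ux|v]; first by apply: cc; exact: cM.
  have [dM DM] := hM v; split=> [x Ux|]; first exact: (derivable_mxP M x v).1 (dM x Ux) i j.
  apply: Ck_on_ext ((IH _).1 DM i j) => x Ux.
  by rewrite derive_mx ?mxE //; exact: dM.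
move=> h; split=> [x Ux|v].
  by apply: continuous_mxP => i j; have [c _] := h i j; exact: c.
have dM x : U x -> derivable M x v.
  by move=> Ux; apply/derivable_mxP => i j; have [_ /(_ v) [d _]] := h i j; exact: d.
split=> //; apply/IH => i j; have [_ /(_ v) [_ D]] := h i j.
by apply: Ck_on_ext D => x Ux; rewrite derive_mx ?mxE //; exact: dM.
Qed.

End SmoothClosure.

(** * Randers metrics from the solved phi *)

Section BilinearForm.
Context {R : realType} {n : nat} (g : 'M[R]_n).
Implicit Types u v w : 'rV[R]_n.

Definition bil u v : R := (u *m g *m v^T) 0 0.

Lemma bilE u v : bil u v = dot (u *m g) v. Proof. by []. Qed.
Lemma bilDl u v w : bil (u + v) w = bil u w + bil v w.
Proof. by rewrite !bilE mulmxDl dotDl. Qed.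
Lemma bilZl a u w : bil (a *: u) w = a * bil u w.
Proof. by rewrite !bilE -scalemxAl dotZl. Qed.
Lemma bilDr u v w : bil w (u + v) = bil w u + bil w v.
Proof. by rewrite !bilE dotDr. Qed.
Lemma bilZr a u w : bil w (a *: u) = a * bil w u.
Proof. by rewrite !bilE dotZr. Qed.
Lemma bil0l u : bil 0 u = 0. Proof. by rewrite bilE mul0mx dot0l. Qed.

Hypothesis gsym : g^T = g.

Lemma bilC u v : bil u v = bil v u.
Proof. by rewrite !bilE (dotC (v *m g)) /dot trmx_mul gsym mulmxA. Qed.

Hypothesis gpos : posdefmx g.

Lemma bil_gt0 u : u != 0 -> 0 < bil u u. Proof. exact: gpos. Qed.
Lemma bil_ge0 u : 0 <= bil u u.
Proof. by have [->|/bil_gt0/ltW//] := eqVneq u 0; rewrite bil0l. Qed.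

(** The square norm of (u, u) v - (u, v) u is (u, u) times the difference of the
    two sides. *)
Lemma bil_CS u v : bil u v ^+ 2 <= bil u u * bil v v.
Proof.
have [->|/bil_gt0 u0] := eqVneq u 0; first by rewrite !bil0l mul0r expr0n.
rewrite -subr_ge0 -(pmulr_rge0 _ u0).
have := bil_ge0 (bil u u *: v - bil u v *: u).
rewrite -scaleNr !(bilDl, bilZl, bilDr, bilZr) (bilC v u); congr (_ <= _); ring.
Qed.

Lemma bil_ratio_le u v : v != 0 ->
  `|bil u v / Num.sqrt (bil v v)| <= Num.sqrt (bil u u).
Proof.
move=> /bil_gt0 v0; rewrite normf_div [X in _ / X]ger0_norm ?sqrtr_ge0 //.
rewrite ler_pdivrMr ?sqrtr_gt0 // -sqrtrM ?bil_ge0 // -sqrtr_sqr ler_sqrt.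
  exact: bil_CS.
by rewrite mulr_ge0 ?bil_ge0.
Qed.

End BilinearForm.

Lemma posdefmx1 {R : realType} n : posdefmx (1%:M : 'M[R]_n).
Proof. by move=> v v0; rewrite mulmx1 -/(dot v v) dot_gt0. Qed.

Section RandersForm.
Context {R : realType} {n : nat} {M : topologicalType}.
Variables (A : set (chart R n M)) (ta : bilfield R n M) (X : vfield R n M).
Variables (beta : covfield R n M) (F : tfunction R n M).
Variables (phi : R -> R) (b k p m : R).
Hypothesis oA : forall c, A c -> open (cimg c).
Hypothesis rta : riemannian_metric A ta.
Hypothesis fF : finsler_metric A F.
Hypothesis obeta : is_oneform A beta.
Hypothesis betaX : forall c x y, A c -> cimg c x ->
  eval_form beta c x y = inner ta c x y (X c x).
Hypothesis Xb : forall c x, A c -> cimg c x ->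
  Num.sqrt (inner ta c x (X c x) (X c x)) <= b.
Hypothesis FE : forall c x y, A c -> cimg c x ->
  F c x y = norm_of ta c x y * phi (eval_form beta c x y / norm_of ta c x y).
Hypothesis p0 : 0 < p.
Hypothesis phiE : forall s : R, `|s| <= b -> 0 < 1 + k * s ^+ 2 /\
  phi s = p * Num.sqrt (1 + k * s ^+ 2) + m * s.

(** The metric whose norm is p sqrt (alpha^2 + k beta^2). *)
Definition randers_metric : bilfield R n M :=
  fun c x => p ^+ 2 *: (ta c x + k *: ((beta c x)^T *m beta c x)).
Definition randers_form : covfield R n M := fun c x => m *: beta c x.

Lemma inner_randers c x y z : inner randers_metric c x y z =
  p ^+ 2 * (inner ta c x y z + k * (eval_form beta c x y * eval_form beta c x z)).
Proof.
rewrite /inner /randers_metric -scalemxAr -scalemxAl [LHS]mxE; congr (_ * _).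
rewrite mulmxDr mulmxDl [LHS]mxE -scalemxAr -scalemxAl; congr (_ + _).
rewrite [LHS]mxE (mulmxA y) -(mulmxA _ (beta c x)) [X in _ * X = _]mxE big_ord1; congr (_ * (_ * _)).
by rewrite -/(dot y (beta c x)) dotC.
Qed.

Lemma eval_randers_form c x y :
  eval_form randers_form c x y = m * eval_form beta c x y.
Proof. by rewrite /eval_form /randers_form -scalemxAl mxE. Qed.

Section AtPoint.
Variables (c : chart R n M) (x : 'rV[R]_n).
Hypotheses (Ac : A c) (cx : cimg c x).
Let tpos := riem_posdef rta Ac cx.
Let tsym := riem_sym rta Ac cx.

Lemma ratio_le y : y != 0 -> `|eval_form beta c x y / norm_of ta c x y| <= b.
Proof.
move=> y0; apply: le_trans (Xb Ac cx).
rewrite betaX // (_ : inner _ _ _ _ _ = bil (ta c x) (X c x) y); last exact: bilC.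
exact: bil_ratio_le.
Qed.

Lemma norm_gt0 y : y != 0 -> 0 < norm_of ta c x y.
Proof. by move=> y0; rewrite sqrtr_gt0; exact: tpos. Qed.

Lemma sqr_norm y : norm_of ta c x y ^+ 2 = inner ta c x y y.
Proof. by rewrite sqr_sqrtr //; exact: bil_ge0. Qed.

Lemma inner_randers_ratio y : y != 0 -> inner randers_metric c x y y =
  p ^+ 2 * (norm_of ta c x y ^+ 2 *
    (1 + k * (eval_form beta c x y / norm_of ta c x y) ^+ 2)).
Proof.
move=> y0; rewrite inner_randers -sqr_norm; congr (_ * _).
by field; rewrite gt_eqF // norm_gt0.
Qed.

Lemma randers_metric_posdef : posdefmx (randers_metric c x).
Proof.
move=> y y0; rewrite -/(inner randers_metric c x y y) inner_randers_ratio //.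
rewrite !mulr_gt0 ?exprn_gt0 ?norm_gt0 //.
by have [] := phiE (ratio_le y0).
Qed.

Lemma randers_formula y :
  F c x y = norm_of randers_metric c x y + eval_form randers_form c x y.
Proof.
rewrite eval_randers_form FE //; have [->|y0] := eqVneq y 0.
  rewrite /norm_of /eval_form /inner !mul0mx trmx0 mulmx0 !mxE sqrtr0.
  by rewrite mul0r mulr0 addr0.
have [w0 ->] := phiE (ratio_le y0); have n0 := norm_gt0 y0.
have -> : norm_of randers_metric c x y = p * norm_of ta c x y
    * Num.sqrt (1 + k * (eval_form beta c x y / norm_of ta c x y) ^+ 2).
  rewrite [LHS]/norm_of inner_randers_ratio // mulrA -exprMn sqrtrM ?sqr_ge0 //.
  by rewrite sqrtr_sqr ger0_norm // mulr_ge0 // ltW.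
by field; rewrite gt_eqF.
Qed.

Lemma randers_metric_sym : (randers_metric c x)^T = randers_metric c x.
Proof. by rewrite /randers_metric !linearZ /= !linearD /= !linearZ /= trmx_mul trmxK tsym. Qed.

(** Let y be dual to the form: the value of the form at y and the square norm of y
    are both N^2, with N the norm of the form.  Then 0 < F (- y) = N - N^2. *)
Lemma form_norm_randers : form_norm randers_metric randers_form c x < 1.
Proof.
pose g := randers_metric c x; pose be := randers_form c x.
have ug : g \in unitmx by exact/posdefmx_unit/randers_metric_posdef.
pose y := be *m invmx g.
have yg : y *m g = be by rewrite mulmxKV.
have N1 : inner randers_metric c x y y = (be *m invmx g *m be^T) 0 0.
  rewrite /inner -/g yg /y trmx_mul trmx_inv randers_metric_sym -/g mulmxA //.
have N2 : eval_form randers_form c x y = inner randers_metric c x y y.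
  by rewrite /eval_form -/be /inner -/g yg.
rewrite /form_norm -/g -/be -N1.
have [y0|y0] := eqVneq y 0; first by rewrite y0 /inner !mul0mx mxE sqrtr0 ltr01.
have y0' : - y != 0 by rewrite oppr_eq0.
have := finsler_pos fF Ac cx y0'; rewrite randers_formula.
have -> : norm_of randers_metric c x (- y) = norm_of randers_metric c x y.
  by rewrite /norm_of /inner linearN /= !mulNmx mulmxN opprK.
have -> : eval_form randers_form c x (- y) = - inner randers_metric c x y y.
  by rewrite -N2 /eval_form linearN /= mulmxN mxE.
rewrite /norm_of; have : 0 < inner randers_metric c x y y by exact: randers_metric_posdef.
move: (inner _ _ _ _ _) => N N0; rewrite -{2}(sqr_sqrtr (ltW N0)).
have := sqrtr_gt0 N; rewrite N0; move: (Num.sqrt N) => r r0.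
by rewrite subr_gt0 expr2 gtr_pMr.
Qed.

End AtPoint.

Lemma randers_of_phi : randers A F.
Proof.
have [sbeta ibeta] := obeta.
split=> //; exists randers_metric, randers_form; split.
- split.
  + move=> c Ac j; have oU := oA Ac.
    have Ct := (Ck_on_mxP oU _ _).1 (riem_smooth rta Ac j).
    have Cb := (Ck_on_mxP oU _ _).1 (sbeta c Ac j).
    apply/(Ck_on_mxP oU) => i l.
    have C := Ck_onM oU (Ck_on_cst oU j (p ^+ 2)) (Ck_onD oU (Ct i l)
      (Ck_onM oU (Ck_on_cst oU j k) (Ck_onM oU (Cb 0 i) (Cb 0 l)))).
    by apply: (Ck_on_ext oU _ C) => x _; rewrite !mxE big_ord1 !mxE.
  + by move=> c x Ac cx; exact: randers_metric_sym.
  + by move=> c x Ac cx; exact: randers_metric_posdef.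
  + move=> c c' Ac Ac' x dx y z; rewrite !inner_randers.
    by rewrite (riem_tensor rta Ac Ac' dx) !(ibeta _ _ Ac Ac' _ dx).
- split.
  + move=> c Ac j; have oU := oA Ac.
    have Cb := (Ck_on_mxP oU _ _).1 (sbeta c Ac j).
    apply/(Ck_on_mxP oU) => i l.
    by apply: (Ck_on_ext oU _ (Ck_onM oU (Ck_on_cst oU j m) (Cb i l))) => x _; rewrite mxE.
  + move=> c c' Ac Ac' x dx y; rewrite !eval_randers_form.
    by rewrite (ibeta _ _ Ac Ac' _ dx).
- by move=> c x Ac cx; exact: form_norm_randers.
- by move=> c x y Ac cx; exact: randers_formula.
Qed.

End RandersForm.

(** * Left-invariant data on the group *)

Section AlphaBetaFunction.
Context {R : realType}.
Variables (phi : R -> R) (b0 : R).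
Hypothesis ab : alpha_beta_function b0 phi.

Let inU (s : R) : `|s| < b0 -> [set` `]- b0, b0[] s.
Proof. by rewrite ltr_norml /= in_itv. Qed.

Let D1 : derive1 phi = 'D_1 phi.
Proof. by apply/funext => s; rewrite derive1E. Qed.
Let D2 : derive1 (derive1 phi) = 'D_1 ('D_1 phi).
Proof. by apply/funext => s; rewrite derive1E D1. Qed.

Lemma abf_derivable (s : R) : `|s| < b0 -> derivable phi s 1.
Proof. by move=> /inU Us; have [_ /(_ 1) [d _]] := abf_smooth ab 1; exact: d. Qed.
Lemma abf_derivable1 (s : R) : `|s| < b0 -> derivable (derive1 phi) s 1.
Proof.
move=> /inU Us; have [_ /(_ 1) [_ [_ /(_ 1) [d _]]]] := abf_smooth ab 2.
by rewrite D1; exact: d.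
Qed.
Lemma abf_continuous2 (s : R) : `|s| < b0 ->
  {for s, continuous (derive1 (derive1 phi))}.
Proof.
move=> /inU Us; have [_ /(_ 1) [_ [_ /(_ 1) [_ [c _]]]]] := abf_smooth ab 2.
by rewrite D2; exact: c.
Qed.
Lemma abf_gt0 (s : R) : `|s| < b0 -> 0 < phi s.
Proof. by rewrite ltr_norml => /(abf_pos ab). Qed.
(** The convexity condition at b = |s|. *)
Lemma abf_psi_gt0 (s : R) : `|s| < b0 -> 0 < psi phi s.
Proof.
move=> sb; have := abf_convex ab (lexx `|s|) sb.
by rewrite (real_normK (num_real s)) subrr mul0r addr0.
Qed.
End AlphaBetaFunction.

Section LeftInvariance.
Context {R : realType} {n : nat} {G : groupTopologicalType}.
Variables (A : set (chart R n G)) (ta : bilfield R n G) (Y Z : vfield R n G).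
Hypothesis mA : smooth_manifold A.
Hypothesis ita : left_invariant_riemannian A ta.
Hypotheses (iY : left_invariant_vfield A Y) (iZ : left_invariant_vfield A Z).

(** The translation by g maps any point to any other one. *)
Lemma left_invariant_inner_cst c c' x x' :
  A c -> A c' -> cimg c x -> cimg c' x' ->
  inner ta c x (Y c x) (Z c x) = inner ta c' x' (Y c' x') (Z c' x').
Proof.
move=> Ac Ac' cx cx'.
pose g := (cinv c' x' * (cinv c x)^-1)%g.
have [q' dq qx] := cx'.
have q'E : cinv c' x' = q' by rewrite -qx (chartK (mfd_chart mA Ac')).
have gx : (g * cinv c x)%g = q' by rewrite /g monoid.mulgVK q'E.
have dx : loc_dom (fun p => g * p)%g c c' x by split=> //; rewrite gx.
have lx : loc (fun p => g * p)%g c c' x = x' by rewrite /loc gx qx.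
have := ita.2 g c c' Ac Ac' x dx (Y c x) (Z c x).
by rewrite -(iY.2 g c c' Ac Ac' x dx) -(iZ.2 g c c' Ac Ac' x dx) lx.
Qed.

End LeftInvariance.

Lemma l55_coef_swap {R : realType} (a b c d e : R) k i j :
  (i < j)%N -> (l55_coef a b c d e j.+1 i.+1)`_k = 0.
Proof.
have z : [:: 0; 0; 0; 0; 0 : R]`_k = 0 by case: k => [|[|[|[|[|k]]]]] //=; rewrite nth_nil.
by case: i j => [|[|[|[|i]]]] [|[|[|[|j]]]].
Qed.

Section FrameData.
Context {R : realType} {G : groupTopologicalType}.
Variables (A : set (chart R 5 G)) (ta : bilfield R 5 G).
Variables (E : 'I_5 -> vfield R 5 G) (a b c d e : R).
Variables (X : vfield R 5 G) (F : tfunction R 5 G).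
Hypothesis mA : smooth_manifold A.
Hypothesis ita : left_invariant_riemannian A ta.
Hypothesis iE : forall i, left_invariant_vfield A (E i).
Hypothesis oE : orthonormal_frame A ta E.
Hypothesis brE : l55_brackets A E a b c d e.
Hypothesis iX : left_invariant_vfield A X.
Variables (b0 : R) (phi : R -> R) (beta : covfield R 5 G).
Hypothesis ab : alpha_beta_function b0 phi.
Hypothesis fF : finsler_metric A F.
Hypothesis betaX : forall ch x y, A ch -> cimg ch x ->
  eval_form beta ch x y = inner ta ch x y (X ch x).
Hypothesis beta_lt : forall ch x, A ch -> cimg ch x -> form_norm ta beta ch x < b0.
Hypothesis FE : forall ch x y, A ch -> cimg ch x ->
  F ch x y = norm_of ta ch x y * phi (eval_form beta ch x y / norm_of ta ch x y).

Definition frame_mx ch u : 'M[R]_5 := \matrix_i E i ch u.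
(** As the frame is orthonormal, y *m coframe_mx ch u is the row of the coordinates
    of y in the frame, by [mul_coframe]. *)
Definition coframe_mx ch u : 'M[R]_5 := ta ch u *m (frame_mx ch u)^T.

Variables (ch : chart R 5 G) (x : 'rV[R]_5).
Hypotheses (Ach : A ch) (cx : cimg ch x).
Local Notation U := (cimg ch).
Local Notation Em := (frame_mx ch).
Local Notation Th := (coframe_mx ch).

Let oU : open U. Proof. exact: chart_open_img (mfd_chart mA Ach). Qed.
Let rta := ita.1.

Lemma frame_coframe u : U u -> Em u *m Th u = 1%:M.
Proof.
move=> Uu; apply/matrixP => i j; rewrite /coframe_mx mulmxA mxE.
rewrite [RHS]mxE -(oE i j Ach Uu) /inner [RHS]mxE; apply: eq_bigr => k _.
congr (_ * _); last by rewrite !mxE.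
by rewrite !mxE; apply: eq_bigr => l _; rewrite mxE.
Qed.

Lemma inner_coframe u y z : U u -> inner ta ch u y z = dot (y *m Th u) (z *m Th u).
Proof.
move=> Uu; have TE := mulmx1C (frame_coframe Uu).
rewrite /dot trmx_mul mulmxA -(mulmxA y) /inner; congr ((_ *m _ *m _) _ _).
by rewrite {2}/coframe_mx trmx_mul trmxK mulmxA TE mul1mx (riem_sym rta Ach Uu).
Qed.

(** The coordinates of X in the frame, which do not depend on the point by
    [coordX_cst]. *)
Definition coordX := X ch x *m Th x.

Lemma mul_coframe u (y : 'rV[R]_5) j : (y *m Th u) 0 j = inner ta ch u y (E j ch u).
Proof.
rewrite /coframe_mx mulmxA /inner !mxE; apply: eq_bigr => k _.
by congr (_ * _); rewrite !mxE.
Qed.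

Lemma coordX_cst u : U u -> X ch u *m Th u = coordX.
Proof.
move=> Uu; apply/rowP => j; rewrite !mul_coframe.
exact: (left_invariant_inner_cst mA ita iX (iE j)).
Qed.

(** The local expression of F is a fixed function of the frame coordinates. *)
Lemma F_coframe u (w : 'rV[R]_5) : U u ->
  F ch u w = dotnorm (w *m Th u) * phi (slope coordX (w *m Th u)).
Proof.
move=> Uu; rewrite FE // betaX // /norm_of !inner_coframe // coordX_cst //.
by rewrite /slope (dotC coordX).
Qed.

Lemma norm_coordX ch' x' : A ch' -> cimg ch' x' ->
  Num.sqrt (inner ta ch' x' (X ch' x') (X ch' x')) = dotnorm coordX.
Proof.
move=> Ac' cx'; rewrite (left_invariant_inner_cst mA ita iX iX Ac' Ach cx' cx).
by rewrite inner_coframe.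
Qed.

Lemma dotnorm_coordX_lt : dotnorm coordX < b0.
Proof.
have := beta_lt Ach cx; rewrite -(norm_coordX Ach cx) /form_norm.
have tsym := riem_sym rta Ach cx.
have ut := posdefmx_unit (riem_posdef rta Ach cx).
have -> : beta ch x = X ch x *m ta ch x.
  apply/rowP => j; have := betaX (dvec R j) Ach cx.
  have ej (v : 'rV[R]_5) : (v *m (dvec R j)^T) 0 0 = v 0 j.
    by rewrite trmx_delta -colE mxE.
  rewrite /eval_form ej => ->.
  have -> : inner ta ch x (dvec R j) (X ch x) = bil (ta ch x) (X ch x) (dvec R j).
    exact: bilC.
  by rewrite /bil ej.
by rewrite mulmxK // trmx_mul tsym mulmxA.
Qed.

Lemma slope_le (z : 'rV[R]_5) : z != 0 -> `|slope coordX z| <= dotnorm coordX.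
Proof.
move=> z0; have := bil_ratio_le (trmx1 _ _) (@posdefmx1 R 5) coordX z0.
by rewrite /bil !mulmx1.
Qed.

Lemma slope_lt (z : 'rV[R]_5) : z != 0 -> `|slope coordX z| < b0.
Proof. by move=> /slope_le /le_lt_trans; apply; exact: dotnorm_coordX_lt. Qed.

Lemma frame_Ck k : Ck_on k U Em.
Proof.
apply/(Ck_on_mxP oU) => i j.
have := (Ck_on_mxP oU _ _).1 ((iE i).1.1 ch Ach k) 0 j.
by apply: Ck_on_ext => // u _; rewrite mxE.
Qed.

Definition dcoframe m : 'M[R]_5 :=
  'D_(dvec R m) (ta ch) x *m (Em x)^T + ta ch x *m ('D_(dvec R m) Em x)^T.

Lemma is_derive_coframe (y : 'rV[R]_5) : is_derive x y Th (linear_ext dcoframe y).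
Proof.
have ht := is_derive_dvec y oU cx (riem_smooth rta Ach 1).
have hE := is_derive_dvec y oU cx (frame_Ck 1).
apply: is_derive_eq (is_derive_mulmx ht (is_derive_trmx hE)) _.
have tZ r (N : 'M[R]_5) : (r *: N)^T = r *: N^T by apply/matrixP => i j; rewrite !mxE.
rewrite raddf_sum mulmx_suml mulmx_sumr -big_split; apply: eq_bigr => m _ /=.
by rewrite tZ -scalemxAl -scalemxAr scalerDr.
Qed.

Lemma derive_frame_row v i : U x -> row i ('D_v Em x) = 'D_v (E i ch) x.
Proof.
move=> Ux.
have [_ /(_ v) [dE _]] := frame_Ck 1.
have [_ /(_ v) [dEi _]] := (iE i).1.1 ch Ach 1.
rewrite (derive_mx (dE x Ux)) (derive_mx (dEi x Ux)).
apply/rowP => j; rewrite !mxE; congr ('D_v _ x).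
by apply/funext => u; rewrite mxE.
Qed.

Lemma frame_bracket i j :
  row j ('D_(row i (Em x)) Em x) - row i ('D_(row j (Em x)) Em x)
  = l55_structure a b c d e i j *m Em x.
Proof.
have rE k : row k (Em x) = E k ch x by rewrite rowK.
rewrite !derive_frame_row // !rE.
have lt (i1 j1 : 'I_5) : (i1 < j1)%N -> 'D_(E i1 ch x) (E j1 ch) x - 'D_(E j1 ch x) (E i1 ch) x
    = l55_structure a b c d e i1 j1 *m Em x.
  move=> ij; have := brE ij Ach cx; rewrite /bracket => ->.
  rewrite mulmx_sum_row; apply: eq_bigr => k _; rewrite rE mxE.
  by rewrite (l55_coef_swap a b c d e k ij) subr0.
case: (ltngtP i j) => [/lt //|/lt h|/val_inj ->].
  by rewrite l55_structure_anti mulNmx -h opprB.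
rewrite subrr (_ : l55_structure _ _ _ _ _ _ _ = 0) ?mul0mx //.
by apply/rowP => k; rewrite !mxE subrr.
Qed.

Hypothesis dF : douglas A F.
Hypotheses (a_gt0 : 0 < a) (d_gt0 : 0 < d) (e_gt0 : 0 < e).

Lemma phi_form : exists k m, forall s : R, `|s| <= dotnorm coordX ->
  0 < 1 + k * s ^+ 2 /\ phi s = phi 0 * Num.sqrt (1 + k * s ^+ 2) + m * s.
Proof.
have [Gam [P [_ sprayE]]] := dF Ach.
have dEm (y : 'rV[R]_5) : derivable Em x y.
  by have [_ /(_ y) [dE _]] := frame_Ck 1; exact: dE.
have FE' u w Uu (_ : w != 0) := @F_coframe u w Uu.
have posF y y0 := @finsler_convex _ _ _ _ _ fF ch x y Ach cx y0.
have [B [Bl Br HN]] := douglas_frame oU cx FE' frame_coframe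
  (fun z z0 => abf_derivable ab (slope_lt z0))
  (fun z z0 => abf_derivable1 ab (slope_lt z0))
  is_derive_coframe dEm frame_bracket posF
  (fun y i y0 => sprayE x y i cx y0).
exact: (l55_phi a_gt0 d_gt0 e_gt0 dotnorm_coordX_lt (abf_derivable ab) (abf_derivable1 ab)
  (abf_continuous2 ab) (abf_gt0 ab) (abf_psi_gt0 ab) Bl Br HN).
Qed.

End FrameData.

Unset Implicit Arguments.

Theorem theorem3p10 (R : realType) (G : groupTopologicalType)
    (A : set (chart R 5 G)) (ta : bilfield R 5 G)
    (E : 'I_5 -> vfield R 5 G) (a b c d e : R)
    (X : vfield R 5 G) (F : tfunction R 5 G) :
  lie_group A ->
  simply_connected R G ->
  nilpotent_group G ->
  left_invariant_riemannian A ta ->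
  (forall i, left_invariant_vfield A (E i)) ->
  orthonormal_frame A ta E ->
  0 < a -> 0 <= b -> 0 <= c -> 0 < d -> 0 < e ->
  l55_brackets A E a b c d e ->
  left_invariant_vfield A X ->
  left_invariant_tfunction A F ->
  alpha_beta_metric A ta X F ->
  ~ is_riemannian A F ->
  douglas A F ->
  randers A F.
Proof.
move=> lA _ _ ita iE oE a0 _ _ d0 e0 brE iX _ [fF [b0 [phi [beta [ab obeta betaX beta_lt FE]]]]] _ dF.
have mA := lie_manifold lA.
have [ch Ach d1] := mfd_cover mA (1%g : G).
have cx : cimg ch (cmap ch 1%g) by exists 1%g.
have [k [m phiE]] := phi_form mA ita iE oE brE iX ab fF betaX beta_lt FE Ach cx dF a0 d0 e0.
have Xb c' x' (Ac' : A c') (cx' : cimg c' x') :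
    Num.sqrt (inner ta c' x' (X c' x') (X c' x')) <= dotnorm (coordX ta E X ch (cmap ch 1%g)).
  by rewrite (norm_coordX mA ita oE iX Ach cx Ac' cx').
apply: (randers_of_phi _ ita.1 fF obeta betaX Xb FE _ phiE).
  by move=> c' Ac'; exact: chart_open_img (mfd_chart mA Ac').
by apply: (abf_gt0 ab); rewrite normr0; exact: abf_b0 ab.
Qed.
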